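(* Let $p\in[1,\infty[$, let $(\Omega,\mathcal F,\mathbb P)$ be an atomless probability space, and let $\rho:L^p(\Omega,\mathcal F,\mathbb P)\to\mathbb R$ be convex, nondecreasing with respect to the $\mathbb P$-almost sure partial order, and law-invariant. Let $f:\mathbb R^n\times\mathbb R^s\to\mathbb R$ be Borel-measurable and limited by an exponent $\gamma\in]0,\infty[$, with set of discontinuity points $D_f$. Let $X\subseteq\mathbb R^n$ be nonempty, let $\mathcal M\subseteq\mathcal M_1^{\|\cdot\|^{\gamma p}}(\mathbb R^s)$ be a locally uniformly $\|\cdot\|^{\gamma p}$-integrating subset, and let $\nu\in\mathcal M$ be such that $(\delta_x\otimes\nu)(D_f)=0$ for every $x\in X$. For $\mu\in\mathcal M_1^{\|\cdot\|^{\gamma p}}(\mathbb R^s)$ set $\varphi(\mu)=\inf\{Q(x,\mu)\mid x\in X\}\in[-\infty,\infty[$ and $\Phi(\mu)=\{x\in X\mid Q(x,\mu)=\varphi(\mu)\}$. Then: (i) The restriction $\varphi|_{\mathcal M}$ is upper semicontinuous at $\nu$ with respect to the topology of weak convergence on $\mathcal M$. (ii) If $X$ is compact, then $\varphi|_{\mathcal M}$ is continuous at $\nu$ and the set-valued mapping $\Phi|_{\mathcal M}$ is upper semicontinuous at $\nu$, both with respect to the topology of weak convergence on $\mathcal M$, and $\Phi(\nu)$ is nonempty and compact.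
   Context: Atomless means that $(\Omega,\mathcal F,\mathbb P)$ supports a random variable $U$ uniformly distributed on $]0,1[$. $\rho$ is law-invariant if $\rho(Y)=\rho(\widetilde Y)$ whenever $Y,\widetilde Y\in L^p(\Omega,\mathcal F,\mathbb P)$ have the same law under $\mathbb P$. $\|\cdot\|$ is the Euclidean norm. A mapping $e:\mathbb R^n\times\mathbb R^s\to\mathbb R$ is limited by the exponent $\gamma\in]0,\infty[$ if there is a locally bounded mapping $\eta:\mathbb R^n\to]0,\infty[$ with $|e(x,z)|\le\eta(x)(\|z\|^\gamma+1)$ for all $(x,z)\in\mathbb R^n\times\mathbb R^s$. For $q>0$, $\mathcal M_1^{\|\cdot\|^q}(\mathbb R^d)$ is the set of Borel probability measures $\mu$ on $\mathbb R^d$ with $\int\|z\|^q\,\mu(dz)<\infty$ (for $d=1$ written $\mathcal M_1^{|\cdot|^q}(\mathbb R)$). A subset $\mathcal M\subseteq\mathcal M_1^{\|\cdot\|^q}(\mathbb R^d)$ is locally uniformly $\|\cdot\|^q$-integrating if for every $\varepsilon>0$ and every $\nu\in\mathcal M$ there is an open neighborhood $\mathcal L$ of $\nu$ with respect to the topology of weak convergence such that $\lim_{a\to\infty}\sup_{\mu\in\mathcal L\cap\mathcal M}\int_{\mathbb R^d}\|z\|^q\,\mathbf 1_{]a,\infty[}(\|z\|^q)\,\mu(dz)\le\varepsilon$. $\mathcal R_\rho:\mathcal M_1^{|\cdot|^p}(\mathbb R)\to\mathbb R$ is defined by $\mathcal R_\rho(\mu)=\rho(F_\mu^{\leftarrow}(U))$,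 where $F_\mu^{\leftarrow}$ is the left-continuous quantile function of the distribution function of $\mu$. $Q:\mathbb R^n\times\mathcal M_1^{\|\cdot\|^{\gamma p}}(\mathbb R^s)\to\mathbb R$ is $Q(x,\nu)=\mathcal R_\rho\big((\delta_x\otimes\nu)\circ f^{-1}\big)$, where $\delta_x$ is the Dirac measure at $x$ and $(\delta_x\otimes\nu)\circ f^{-1}$ is the image measure under $f$ (which has finite absolute moment of order $p$ under the growth assumption on $f$). A set-valued mapping $\Phi$ from a topological space to subsets of $X$ is upper semicontinuous at $\nu$ if for every open set $\mathcal O\subseteq\mathbb R^n$ with $\Phi(\nu)\subseteq\mathcal O$ there is a neighborhood of $\nu$ on which $\Phi(\mu)\subseteq\mathcal O$. *)

(* Defs.v *)
From HB Require Import structures.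
From mathcomp Require Import all_boot all_order all_algebra.
From mathcomp Require Import all_classical all_reals all_analysis.

Set Implicit Arguments.
Unset Strict Implicit.
Unset Printing Implicit Defensive.

Import Order.TTheory GRing.Theory Num.Theory.
Import numFieldNormedType.Exports.

Local Open Scope classical_set_scope.
Local Open Scope ring_scope.

(* Borel sigma-algebra on R^n = 'rV[R]_n. The library norm on 'rV[R]_n is the
   sup norm, which induces the same topology as the Euclidean norm below. *)
HB.instance Definition _ (R : realType) (m n : nat) :=
  Measurable.copy 'M[R]_(m, n) (g_sigma_algebraType (@open 'M[R]_(m, n))).

Definition enorm (R : realType) (n : nat) (x : 'rV[R]_n) : R :=
  Num.sqrt (\sum_(i < n) x 0 i ^+ 2).

Section weak_convergence.
Variables (R : realType) (n : nat).

Definition bounded_continuous :=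
  {h : 'rV[R]_n -> R | continuous h /\ bounded_fun h}.

(* Topology of weak convergence: the coarsest one making mu |-> \int h dmu
   continuous for every bounded continuous h. On a subset M of probability
   measures it is the trace, whose neighborhood filter at a point nu of M is
   within M (nbhs nu). *)
HB.instance Definition _ :=
  Topological.copy (probability 'rV[R]_n R)
    (sup_topology (fun h : bounded_continuous =>
       Topological.class (initial_topology
         (fun mu : probability 'rV[R]_n R => \int[mu]_z sval h z)))).

End weak_convergence.

Section product_probability.
Context d1 d2 (T1 : measurableType d1) (T2 : measurableType d2) (R : realType).
Variables (P1 : probability T1 R) (P2 : probability T2 R).

Let prod_setT : (P1 \x P2)%E setT = 1%E.
Proof.
rewrite -setXTT [LHS]product_measure1E// -[RHS]mule1.
by congr (_ * _)%E; exact: probability_setT.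
Qed.

HB.instance Definition _ :=
  Measure_isProbability.Build _ _ _ (P1 \x P2)%E prod_setT.

End product_probability.

Definition finite_moment (R : realType) (n : nat) (q : R) :
    set (probability 'rV[R]_n R) :=
  [set mu | (\int[mu]_z ((enorm z `^ q)%:E) < +oo)%E].

(* The tail supremum is nonincreasing in a and nonnegative, so that its limit at
   +oo exists in \bar R and lim is not a default value. *)
Definition locally_uniformly_integrating (R : realType) (n : nat) (q : R)
    (M : set (probability 'rV[R]_n R)) : Prop :=
  forall eps : R, 0 < eps -> forall nu, M nu ->
  exists L : set (probability 'rV[R]_n R),
    [/\ open L, L nu &
      (lim ((fun a : R => ereal_sup
         [set \int[mu]_z ((enorm z `^ q * \1_(`]a, +oo[) (enorm z `^ q))%:E)
         | mu in L `&` M]) @ +oo%R) <= eps%:E)%E].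

Definition limited_by (R : realType) (n s : nat) (gamma : R)
    (e : 'rV[R]_n * 'rV[R]_s -> R) : Prop :=
  exists eta : 'rV[R]_n -> R,
    [/\ forall x : 'rV[R]_n, 0 < eta x,
        forall x : 'rV[R]_n, bounded_near eta (nbhs x) &
        forall x z, `|e (x, z)| <= eta x * (enorm z `^ gamma + 1)].

Definition discontinuity_points (T U : topologicalType) (f : T -> U) : set T :=
  [set t | ~ {for t, continuous f}].

(* Laws are compared on measurable sets only: a measure of the library is a
   function on all sets, with unspecified values outside the sigma-algebra. *)
Definition uniform01 (d : measure_display) (T : measurableType d)
    (R : realType) (P : probability T R) (U : {RV P >-> R}) : Prop :=
  forall A : set R, measurable A ->
    distribution P U A = uniform_prob (@ltr01 R) A.

(* Left-continuous quantile function. It is only meaningful on ]0, 1[, and takes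
   finite (default) values elsewhere. *)
Definition quantile (R : realType) (mu : probability R R) (u : R) : R :=
  inf [set y : R | (u%:E <= mu `]-oo, y]%classic)%E].

Section risk.
Context (d : measure_display) (T : measurableType d) (R : realType)
  (P : probability T R) (p : R) (p1 : (1 <= p%:E)%E).

Definition ae_nondecreasing (rho : LfunType P p1 -> R) : Prop :=
  forall Y Z : LfunType P p1,
    {ae P, forall w, Y w <= Z w} -> rho Y <= rho Z.

Definition law_invariant (rho : LfunType P p1 -> R) : Prop :=
  forall Y Z : LfunType P p1,
    (forall A : set R, measurable A ->
       distribution P Y A = distribution P Z A) ->
    rho Y = rho Z.

Variables (rho : LfunType P p1 -> R) (U : {RV P >-> R}).

(* R_rho(mu) = rho(F_mu^<-(U)). insubd views the function quantile mu \o U as an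
   element of L^p; when U is uniform, the default 0 is reached only if mu has no
   finite absolute moment of order p. *)
Definition Rrho (mu : probability R R) : R :=
  rho (insubd (0 : LfunType P p1) (quantile mu \o U)).

Variables (n s : nat) (f : {mfun ('rV[R]_n * 'rV[R]_s)%type >-> R}).

Definition Qfun (x : 'rV[R]_n) (mu : probability 'rV[R]_s R) : R :=
  Rrho (distribution (\d_x \x mu)%E f).

Variable X : set 'rV[R]_n.

Definition optval (mu : probability 'rV[R]_s R) : \bar R :=
  ereal_inf [set (Qfun x mu)%:E | x in X].

Definition optset (mu : probability 'rV[R]_s R) : set 'rV[R]_n :=
  [set x | X x /\ (Qfun x mu)%:E = optval mu].

End risk.

Definition usc_within (T : topologicalType) (R : realType) (M : set T)
    (g : T -> \bar R) (t : T) : Prop :=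
  forall a : R, (g t < a%:E)%E ->
    \forall u \near within M (nbhs t), (g u < a%:E)%E.

Definition set_usc_within (T V : topologicalType) (M : set T)
    (F : T -> set V) (t : T) : Prop :=
  forall O : set V, open O -> F t `<=` O ->
    \forall u \near within M (nbhs t), F u `<=` O.

(* Main.v *)
(* A convex nondecreasing functional is continuous for the L^p distance, so for
   the joint continuity of Q at (x, nu) it is enough that the quantile function of
   the law of f(x', .) under mu is L^p-close to that of f(x, .) under nu for
   (x', mu) near (x, nu). Uniform integrability reduces this to truncated
   quantiles, which are compared cell by cell on a grid of [-K, K]: two quantile
   functions stay two cells apart at most outside an event whose probability is
   controlled by finitely many values of the distribution functions. These values
   are controlled by integrals of bounded functions g that are continuous at (x, z)
   for nu-almost every z, and such integrals are upper semicontinuous in (x', mu)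
   because g is dominated by its Lipschitz sup-convolutions, which decrease to g at
   the points of continuity. The claims on the optimal value and the optimal set
   then follow by compactness. Working with filters instead of sequences avoids the
   metrizability of the weak topology. *)
Require Import Defs.
From HB Require Import structures.
From mathcomp Require Import all_boot all_order all_algebra.
From mathcomp Require Import all_classical all_reals all_analysis.
From mathcomp Require Import measurable_realfun ring lra.

Set Implicit Arguments.
Unset Strict Implicit.
Unset Printing Implicit Defensive.

Import Order.TTheory GRing.Theory Num.Theory.
Import numFieldNormedType.Exports.

Local Open Scope classical_set_scope.
Local Open Scope ring_scope.

(** * Continuity of convex nondecreasing functionals on $L^p$ *)

Lemma Lfun_of_integral_lty d (T : measurableType d) (R : realType) (P : probability T R)
    (p : R) (g : T -> R) : 0 < p -> measurable_fun setT g ->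
  (\int[P]_w (`|g w| `^ p)%:E < +oo)%E -> g \in Lfun P p%:E.
Proof.
move=> p0 mg ig; rewrite inE; apply/andP; split; rewrite inE//.
rewrite /finite_norm /=.
have : ('N[P]_p%:E[EFin \o g] `^ p < +oo)%E.
  by rewrite poweR_Lnorm ?gt_eqF.
by case: (Lnorm _ _ _) => [r| |]; rewrite ?ltry ?ltNyr //= gt_eqF.
Qed.

Section convex_monotone.
Context (R : realType) (p : R) (p1 : (1 <= p%:E)%E)
  (d : measure_display) (T : measurableType d) (P : probability T R).
Local Notation L := (LfunType P p1).

(* The majorant is the p-th root of [\sum_k (k.+1 * |Z k|) ^ p]. *)
Lemma Lfun_majorant (Z : nat -> L) :
  (forall k, \int[P]_w (`|Z k w| `^ p)%:E
     <= ((k.+1%:R `^ p)^-1 * 2^-1 ^+ k.+1)%:E)%E ->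
  exists Y : L, forall k, {ae P, forall w, k.+1%:R * `|Z k w| <= Y w}.
Proof.
move=> HZ.
have p0 : 0 < p by move: p1; rewrite lee_fin; exact: lt_le_trans.
pose g k w : \bar R := ((k.+1%:R * `|Z k w|) `^ p)%:E.
have mg k : measurable_fun setT (g k).
  apply/measurable_EFinP.
  apply: (measurableT_comp (measurable_powR p)).
  by apply: measurable_funM => //; apply: measurableT_comp.
have g0 k w : (0 <= g k w)%E by rewrite lee_fin powR_ge0.
pose W w := (\sum_(k <oo) g k w)%E.
have mW : measurable_fun setT W by exact: ge0_emeasurable_sum.
have W0 w : (0 <= W w)%E by exact: nneseries_ge0.
(* The factor $(k+1)^p$ pulled out of the $k$-th term cancels against the hypothesis, leaving at
   most $2^{-(k+1)}$; these bounds sum to 1. *)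
have iW : (\int[P]_w W w <= 1)%E.
  rewrite integral_nneseries//.
  have <- : (\sum_(k <oo) (2^-1 ^+ k.+1)%:E = 1%:E :> \bar R)%E.
    have := @cvg_geometric_eseries_half R 1 0; rewrite expr0 divr1 => /cvg_lim <-//.
    by apply: eq_eseriesr => k _; rewrite addn1 natrX exprVn div1r.
  apply: lee_nneseries => k _; first by move=> _; exact: integral_ge0.
  under eq_integral do rewrite /g powRM// EFinM.
  rewrite ge0_integralZl//; last first.
    by apply/measurable_EFinP; apply: (measurableT_comp (measurable_powR p));
      exact: measurableT_comp.
  have k0 : (0 < (k.+1%:R `^ p)%:E :> \bar R)%E by rewrite lte_fin powR_gt0.
  apply: (le_trans (_ : (_ <= (k.+1%:R `^ p)%:E *
      ((k.+1%:R `^ p)^-1 * 2^-1 ^+ k.+1)%:E)%E)); first by rewrite lee_pmul2l.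
  by rewrite -EFinM mulVKf ?gt_eqF ?powR_gt0.
have fW w : (0 <= fine (W w)) by exact: fine_ge0.
have mfW : measurable_fun setT (fine \o W) by exact: measurableT_comp.
pose y w := fine (W w) `^ p^-1.
have my : measurable_fun setT y.
  exact: (measurableT_comp (measurable_powR _)).
have yL : y \in Lfun P p%:E.
  apply: Lfun_of_integral_lty => //; apply: (le_lt_trans (y := 1%E)); last exact: ltry.
  apply: le_trans iW; apply: ge0_le_integral => //.
  - apply/measurable_EFinP; apply: (measurableT_comp (measurable_powR p)).
    exact: measurableT_comp.
  - move=> w _; rewrite ger0_norm ?powR_ge0// -powRrM mulVf ?gt_eqF// powRr1//.
    by case: (W w) (W0 w) => [r| |]//= _; rewrite ?leey.
have [Y YE] : exists Y : L, Y = y :> (T -> R).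
  by exists (Lfun_Sub p1 yL).
exists Y => k.
(* Where [W w] is infinite, [fine] returns the default 0 and [y w] is no majorant; integrability
   makes that event null. *)
have : P.-integrable setT W.
  apply/integrableP; split => //.
  under eq_integral do rewrite gee0_abs//.
  by apply: (le_lt_trans iW); rewrite ltry.
move/(integrable_ae measurableT); apply: filterS => w /(_ I) Wfin.
have a0 : 0 <= k.+1%:R * `|Z k w| by rewrite mulr_ge0.
rewrite YE /y -[leLHS](_ : ((k.+1%:R * `|Z k w|) `^ p) `^ p^-1 = _); last first.
  by rewrite -powRrM mulfV ?gt_eqF// powRr1.
rewrite ge0_ler_powR ?nnegrE ?powR_ge0 ?invr_ge0 ?(ltW p0)//.
rewrite -lee_fin fineK//.
have := @nneseries_lim_ge _ (g ^~ w) xpredT 0 k.+1 (fun n _ _ => g0 n w).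
by apply: le_trans; rewrite big_nat_recr//= leeDr// sume_ge0.
Qed.

Variables (rho : L -> R) (rho_convex : convex_function setT rho)
  (rho_nondecreasing : ae_nondecreasing rho).

Lemma convex_le (t : R) (Y Z : L) : 0 <= t <= 1 ->
  rho (t *: Y + (1 - t) *: Z) <= t * rho Y + (1 - t) * rho Z.
Proof.
move=> /andP[t0 t1].
have ti : Itv.spec (@Itv.num_sem R) (Itv.Real `[0%Z, 1%Z]) t.
  by rewrite /= /Itv.num_sem/= num_real /= in_itv/= t0 t1.
have := rho_convex (Itv.mk ti) (mem_set I : Y \in setT) (mem_set I : Z \in setT).
exact.
Qed.

(* Otherwise [Z k <= Z0 + Y / k.+1] with a single [Y] for perturbations [Z k] of
   [Z0] that are small enough, and convexity along [Z0, Z0 + Y] concludes. *)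
Lemma convex_monotone_usc (Z0 : L) (e : R) : 0 < e ->
  exists2 del : R, 0 < del & forall Z : L,
    (\int[P]_w (`|Z w - Z0 w| `^ p)%:E < del%:E)%E -> rho Z < rho Z0 + e.
Proof.
move=> e0; apply: contrapT => H.
pose del k : R := (k.+1%:R `^ p)^-1 * 2^-1 ^+ k.+1.
have del0 k : 0 < del k.
  by rewrite mulr_gt0 ?exprn_gt0 ?invr_gt0 ?powR_gt0.
have {}H k : exists Z : L,
    (\int[P]_w (`|Z w - Z0 w| `^ p)%:E < (del k)%:E)%E /\ rho Z0 + e <= rho Z.
  apply: contrapT => Hk; apply: H; exists (del k) => // Z HZ.
  by rewrite ltNge; apply/negP => hz; apply: Hk; exists Z.
have [Z HZ] := choice H.
have [k|Y HY] := @Lfun_majorant (fun k => Z k - Z0); first exact/ltW/(HZ k).1.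
have key k : k.+1%:R * e <= rho (Y + Z0) - rho Z0.
  have k0 : 0 < k.+1%:R :> R by [].
  have : rho (Z k) <= rho (k.+1%:R^-1 *: (Y + Z0) + (1 - k.+1%:R^-1) *: Z0).
    apply: rho_nondecreasing; apply: filterS (HY k) => w /= Hw.
    suff : Z k w <= k.+1%:R^-1 * (Y w + Z0 w) + (1 - k.+1%:R^-1) * Z0 w by [].
    have -> : k.+1%:R^-1 * (Y w + Z0 w) + (1 - k.+1%:R^-1) * Z0 w
       = k.+1%:R^-1 * Y w + Z0 w by ring.
    rewrite -lerBlDr ler_pdivlMl//; apply: le_trans Hw.
    by rewrite ler_wpM2l// ler_norm.
  have /convex_le : 0 <= (k.+1%:R^-1 : R) <= 1.
    by rewrite invr_ge0 ler0n invf_le1 ?ler1n.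
  move=> /(_ (Y + Z0) Z0) h1 h2.
  have h3 := le_trans (HZ k).2 (le_trans h2 h1).
  rewrite -ler_pdivlMl//; move: h3.
  by move: (rho (Y + Z0)) (rho Z0) (k.+1%:R^-1) => a b t; rewrite mulrBr mulrBl; lra.
(* The right-hand side of [key] does not depend on [k], so a [k.+1] above the quotient by [e] gives
   the contradiction. *)
have := key (Num.truncn ((rho (Y + Z0) - rho Z0) / e)).
rewrite -ler_pdivlMr// leNgt => /negP; apply.
exact: Num.Theory.truncnS_gt.
Qed.

Lemma convex_monotone_continuous (Z0 : L) (e : R) : 0 < e ->
  exists2 del : R, 0 < del & forall Z : L,
    (\int[P]_w (`|Z w - Z0 w| `^ p)%:E < del%:E)%E -> `|rho Z - rho Z0| < e.
Proof.
move=> /(convex_monotone_usc Z0)[del d0 H]; exists del => // Z HZ.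
have h1 := H _ HZ.
(* The lower bound follows from the upper one at the reflection of [Z]. *)
have h2 : rho (Z0 + Z0 - Z) < rho Z0 + e.
  apply: H; apply: le_lt_trans HZ; rewrite le_eqVlt; apply/orP; left; apply/eqP.
  apply: eq_integral => w _ /=; congr (_ `^ _)%:E.
  rewrite -[RHS]normrN.
  suff : `|Z0 w + Z0 w - Z w - Z0 w| = `|- (Z w - Z0 w)| by [].
  by congr `|_|; ring.
(* [Z0] is the midpoint of [Z] and its reflection, so convexity bounds [rho Z] below by $2\rho(Z_0)$
   minus the value at the reflection. *)
have h3 : rho Z0 <= 2^-1 * rho Z + (1 - 2^-1) * rho (Z0 + Z0 - Z).
  rewrite -[leLHS](_ : rho (2^-1 *: Z + (1 - 2^-1) *: (Z0 + Z0 - Z)) = _).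
    by apply: convex_le; lra.
  congr rho.
  apply/LfuneqP => w.
  suff : 2^-1 * Z w + (1 - 2^-1) * (Z0 w + Z0 w - Z w) = Z0 w by [].
  by field.
rewrite ltr_norml; apply/andP; split; lra.
Qed.

End convex_monotone.

(** * Quantile functions and inverse transform sampling *)

Section quantile.
Context (R : realType) (d : measure_display) (T : measurableType d)
  (P : probability T R) (X : {RV P >-> R}).
Local Notation q := (quantile (distribution P X)).

(** The limit 1 of the distribution function at $+\infty$ makes the set nonempty, and the limit 0 at
    $-\infty$ bounds it below. *)
Lemma quantile_has_inf (u : R) : 0 < u < 1 ->
  has_inf [set y : R | (u%:E <= cdf X y)%E].
Proof.
move=> /andP[u0 u1]; split.
  have /(_ [set y | (u%:E < y)%E])[] := cvg_cdfy1 X.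
    by apply: open_nbhs_nbhs; split; [exact: open_ereal_gt_ereal | rewrite /= lte_fin].
  move=> M [_ HM]; exists (M + 1) => /=; apply/ltW/HM; lra.
have /(_ [set y | (y < u%:E)%E])[] := cvg_cdfNy0 X.
  by apply: open_nbhs_nbhs; split; [exact: open_ereal_lt_ereal | rewrite /= lte_fin].
move=> M [_ HM]; exists (M - 1) => y /=; apply: contra_leP => yM.
by apply: HM; lra.
Qed.

(** The Galois connection between quantile and distribution functions. It rests on right continuity:
    if $F(t)<u$, then $F(t+e/2)<u$ for some $e>0$, so every competitor in the infimum lies beyond
    $t+e/2$. *)
Lemma quantile_le (u t : R) : 0 < u < 1 -> (q u <= t) = (u%:E <= cdf X t)%E.
Proof.
move=> u01; have [ne lb] := quantile_has_inf u01.
apply/idP/idP => [|h]; last by apply: ge_inf.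
apply: contra_leT; rewrite -ltNge => h.
have := @cdf_right_continuous _ _ _ _ X t => /(_ [set y | (y < u%:E)%E])[].
  by apply: open_nbhs_nbhs; split; [exact: open_ereal_lt_ereal | ].
move=> e /= e0 He.
have {}He : (cdf X (t + e / 2) < u%:E)%E.
  apply: He; last by lra.
  by rewrite /= opprD addNKr normrN gtr0_norm; lra.
apply: (lt_le_trans (_ : t < t + e / 2)); first by lra.
apply: lb_le_inf => // y /= uy; rewrite leNgt; apply/negP => /ltW yt.
move: uy; apply/negP; rewrite -ltNge.
by apply: le_lt_trans He; exact: cdf_nondecreasing.
Qed.

(* Outside ]0, 1[ the quantile function takes the default values of [inf]. *)
Lemma quantile_measurable : measurable_fun setT q.
Proof.
have -> : setT = `]0, 1[%classic `|` (`]-oo, 0] `|` ([set 1] `|` `]1, +oo[)) :> set R.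
  apply/seteqP; split => u // _; rewrite /= !in_itv /= !andbT.
  have [|u0] := leP u 0; first by right; left.
  have [u1|u1|->] := ltgtP u 1; [by left | by right; right; right | by right; right; left].
apply/measurable_funU => //; first by apply: measurableU => //; exact: measurableU.
split.
  apply: (measurability (@RGenCInfty.G R)) => [|/= _ [_] [r] -> <-].
    exact: RGenCInfty.measurableE.
  (* On $]0,1[$ the quantile function is nondecreasing, so the preimage of a half-line is an
     interval. *)
  apply: is_interval_measurable => s t/=.
  rewrite !in_itv/= !andbT => -[s01 fs] [t01 ft] u /andP[su ut].
  have u01 : 0 < u < 1 by lra.
  split; first by rewrite in_itv.
  rewrite /= in_itv/= andbT (le_trans fs)// quantile_le//.
  by rewrite (@le_trans _ _ u%:E) ?lee_fin// -quantile_le.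
apply/measurable_funU => //; first exact: measurableU.
split.
  apply: (eq_measurable_fun (fun=> 0 : R)) => // u /set_mem; rewrite /= in_itv/= => u0.
  rewrite /quantile (_ : [set _ | _] = setT).
    rewrite inf_out// => -[_ [m /(_ (m - 1) I)]]; lra.
  by apply/seteqP; split => y //= _; rewrite (@le_trans _ _ 0%E)// lee_fin.
apply/measurable_funU => //; split.
  by apply: (eq_measurable_fun (fun=> q 1)) => // u /set_mem /= ->.
apply: (eq_measurable_fun (fun=> 0 : R)) => // u /set_mem; rewrite /= in_itv/= andbT => u0.
rewrite /quantile (_ : [set _ | _] = set0) ?inf0//.
apply/seteqP; split => y //=; rewrite leNgt => /negP; apply.
by rewrite (le_lt_trans (cdf_le1 X y))// lte_fin.
Qed.

End quantile.

Section uniform.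
Context (R : realType) (d : measure_display) (T : measurableType d)
  (P : probability T R) (U : {RV P >-> R}) (U01 : uniform01 U).

Lemma uniform01E (A : set R) : measurable A ->
  P (U @^-1` A) = lebesgue_measure (A `&` `[0, 1]%classic).
Proof.
move=> mA; have := U01 mA; rewrite /distribution /pushforward => ->.
rewrite /uniform_prob integral_uniform_pdf.
rewrite (eq_integral (cst 1%E)); last first.
  move=> x /set_mem [_ /=]; rewrite in_itv/= /uniform_pdf => ->.
  by rewrite subr0 invr1.
by rewrite integral_cst ?mul1e//; exact: measurableI.
Qed.

Lemma uniform01_itv (a h : R) : 0 <= h ->
  (P (U @^-1` `]a, (a + h)%R]) <= h%:E)%E.
Proof.
move=> h0; rewrite uniform01E//.
apply: (@le_trans _ _ (lebesgue_measure `]a, (a + h)%R]%classic)).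
  by rewrite le_measure// inE//; exact: measurableI.
rewrite lebesgue_measure_itv/= lte_fin ltrDl; case: ifP => _; last by rewrite lee_fin.
by rewrite -EFinD addrAC subrr add0r.
Qed.

Lemma uniform01_ae : {ae P, forall w, 0 < U w < 1}.
Proof.
exists (U @^-1` (~` `]0, 1[%classic)); split.
- by apply: measurable_funPTI => //; exact: measurableC.
- rewrite uniform01E//; last exact: measurableC.
  apply/eqP; rewrite eq_le measure_ge0 andbT.
  (* Within $[0,1]$, the complement of $]0,1[$ consists of the two endpoints. *)
  rewrite (@le_trans _ _ (lebesgue_measure [set (0:R); 1]))//.
    rewrite le_measure// ?inE//; first by apply: measurableI => //; exact: measurableC.
      exact: measurableU.
    move=> x [/= + ]; rewrite !in_itv/= => /negP h /andP[x0 x1].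
    by move: h; rewrite negb_and -!leNgt => /orP[h|h]; [left|right]; apply/eqP; rewrite eq_le ?h ?x0 ?x1.
  by rewrite countable_lebesgue_measure0//; apply: finite_set_countable.
- by move=> w /= h; rewrite in_itv.
Qed.

Lemma uniform01_cdf (c : R) : 0 <= c <= 1 -> P (U @^-1` `]-oo, c]) = c%:E.
Proof.
move=> /andP[c0 c1]; rewrite uniform01E//.
rewrite (_ : _ `&` _ = `[0, c]%classic).
  rewrite lebesgue_measure_itv/= lte_fin; case: ltP; first by rewrite sube0.
  by move=> h; congr EFin; apply: le_anti; rewrite c0 h.
apply/seteqP; split => x /=; rewrite !in_itv/=; first by move=> [-> /andP[-> _]].
by move=> /andP[-> xc]; rewrite xc (le_trans xc).
Qed.

End uniform.

Lemma measure_ae_eq d (T : measurableType d) (R : realType)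
    (mu : {measure set T -> \bar R}) (A B : set T) :
  measurable A -> measurable B -> {ae mu, forall w, A w <-> B w} -> mu A = mu B.
Proof.
move=> mA mB AB; rewrite -(setIT A) -(setIT B) -!integral_indic//.
apply: ae_eq_integral => //.
- by apply/measurable_EFinP; exact: measurable_indic.
- by apply/measurable_EFinP; exact: measurable_indic.
- apply: filterS AB => w AB _; rewrite !indicE; congr (_%:R%:E).
  by congr nat_of_bool; apply/idP/idP => /set_mem/AB/mem_set.
Qed.

Section quantile_law.
Context (R : realType) (d : measure_display) (T : measurableType d)
  (P : probability T R) (U : {RV P >-> R}) (U01 : uniform01 U)
  (d' : measure_display) (T' : measurableType d')
  (P' : probability T' R) (X : {RV P' >-> R}).
Local Notation q := (quantile (distribution P' X)).

Lemma quantile_RV_measurable : measurable_fun setT (q \o U).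
Proof. exact: measurableT_comp (quantile_measurable X) _. Qed.

(** Open upper half-lines form a generating family stable under intersection, so comparing
    distribution functions is enough. Almost surely $q(U)\le x$ amounts to $U\le F(x)$, an event of
    probability $F(x)$. *)
Lemma quantile_law (Y : {RV P >-> R}) (A : set R) : Y = q \o U :> (T -> R) ->
  measurable A -> distribution P Y A = distribution P' X A.
Proof.
move=> YE.
move=> mA; apply: (@measure_unique _ R _ (@RGenOInfty.G R)
  (fun n => `]- n%:R, +oo[%classic)) => //.
- exact: RGenOInfty.measurableE.
- move=> _ _ [x ->] [y ->]; exists (Num.max x y).
  by apply/seteqP; split => z /=; rewrite !in_itv/= !andbT gt_max => /andP.
- by move=> n; exists (- n%:R).
- apply/seteqP; split => x // _; exists (Num.truncn (- x)).+1 => //=.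
  by rewrite in_itv/= andbT ltrNl Num.Theory.truncnS_gt.
- move=> _ [x ->]; rewrite -setCitvl.
  apply: (etrans (probability_setC (distribution P Y) _)) => //.
  apply: (etrans _ (esym (probability_setC (distribution P' X) _))) => //.
  congr (_ - _)%E; rewrite -[RHS]/(cdf X x).
  have [c cE] : exists c, cdf X x = c%:E.
    by exists (fine (cdf X x)); rewrite fineK// fin_num_measure.
  have c01 : 0 <= c <= 1.
    by rewrite -!lee_fin -cE cdf_ge0 cdf_le1.
  rewrite cE -(uniform01_cdf U01 c01).
  rewrite -[LHS]/(P (Y @^-1` `]-oo, x]%classic)) YE; apply: measure_ae_eq.
  - by rewrite -YE; exact: measurable_funPTI.
  - exact: measurable_funPTI.
  - apply: filterS (uniform01_ae U01) => w w01 /=.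
    by rewrite !in_itv/= quantile_le// cE lee_fin.
- by move=> n; rewrite (le_lt_trans (probability_le1 _ _))// ltry.
Qed.

Lemma quantile_integral (g : R -> \bar R) : measurable_fun setT g ->
  (forall y, 0 <= g y)%E ->
  (\int[P]_w g (q (U w)) = \int[P']_w g (X w))%E.
Proof.
move=> mg g0.
have [Y YE] : exists Y : {RV P >-> R}, Y = q \o U :> (T -> R).
  by exists (mfun_Sub (mem_set quantile_RV_measurable)).
transitivity (\int[P]_w (g \o Y) w)%E; first by rewrite YE.
rewrite -ge0_integral_distribution// -[RHS]ge0_integral_distribution//.
by apply: eq_measure_integral => A mA _; exact: quantile_law.
Qed.

End quantile_law.

(** * Truncation to $[-K,K]$ and comparison on a grid *)

Section clamp.
Context (R : realType).
Implicit Types (K h a b p : R).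

Definition clamp K a := Num.max (- K) (Num.min K a).

Lemma clamp_bounds K a : 0 <= K -> - K <= clamp K a <= K.
Proof.
move=> K0; rewrite /clamp; case: (leP K a) => h.
  by case: (leP (- K) K) => h2; lra.
by case: (leP (- K) a) => h2; lra.
Qed.

Lemma dist_clamp2 K a b : 0 <= K -> `|clamp K a - clamp K b| <= 2 * K.
Proof.
move=> K0; have := clamp_bounds a K0; have := clamp_bounds b K0.
by rewrite ler_norml; lra.
Qed.

Lemma clampE K a : `|a| <= K -> clamp K a = a.
Proof.
rewrite ler_norml => /andP[h1 h2]; rewrite /clamp.
by rewrite (min_idPr h2) (max_idPr h1).
Qed.

Lemma dist_clamp K a : 0 <= K -> `|a - clamp K a| <= `|a|.
Proof.
move=> K0; rewrite /clamp; case: (leP K a) => h.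
  by case: (leP (- K) K) => h2; [rewrite !ger0_norm; lra | lra].
by case: (leP (- K) a) => h2; [rewrite subrr normr0 | rewrite !ltr0_norm; lra].
Qed.

(** For $|a|<K$, the first grid point strictly above $a$ is at most one cell away and still has
    index at most $m$, because $m$ cells cover $[-K,K]$. The hypothesis there puts $b$ at most one
    further cell up, which explains the factor 2. *)
Lemma clamp_grid K h (m : nat) a b : 0 < K -> 0 < h -> 2 * K <= m%:R * h ->
  (forall j : nat, (j <= m)%N -> a <= - K + j%:R * h -> b <= - K + j%:R * h + h) ->
  clamp K b <= clamp K a + 2 * h.
Proof.
move=> K0 h0 Km H; have [cb1 cb2] := andP (clamp_bounds b (ltW K0)).
have [ca1 ca2] := andP (clamp_bounds a (ltW K0)).
have [aK|aK] := leP a (- K).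
  have /= := H 0%N (leq0n _); rewrite mul0r addr0 => /(_ aK) hb.
  apply: (@le_trans _ _ (- K + h)); last lra.
  by rewrite /clamp ge_max; apply/andP; split; [lra | rewrite ge_min hb orbT].
have [Ka|Ka] := leP K a.
  suff : clamp K a = K by lra.
  by rewrite /clamp (min_idPl Ka) (max_idPr _)//; lra.
have -> : clamp K a = a by rewrite clampE// ler_norml !ltW.
pose j := Num.truncn ((a + K) / h).
have aKh : 0 <= (a + K) / h by rewrite divr_ge0//; lra.
have /andP[j1 j2] := Num.Theory.truncn_itv aKh.
have {}j1 : j%:R * h <= a + K by rewrite -ler_pdivlMr.
have {}j2 : a + K < j.+1%:R * h by rewrite -ltr_pdivrMr.
have jm : (j.+1 <= m)%N.
  rewrite -(ltr_nat R) -(ltr_pM2r h0); lra.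
have := H _ jm; rewrite -natr1 mulrDl mul1r in j2 * => /(_ ltac:(lra)) hb.
by rewrite /clamp ge_max; apply/andP; split; [lra | rewrite ge_min; apply/orP; right; lra].
Qed.

(** The sum is at most three times the largest term, and the power of that term is one of the three
    summands on the right. *)
Lemma powR_sum3 p (x y z : R) : 0 <= p -> 0 <= x -> 0 <= y -> 0 <= z ->
  (x + y + z) `^ p <= 3 `^ p * (x `^ p + y `^ p + z `^ p).
Proof.
move=> p0 x0 y0 z0.
have H m : 0 <= m -> x <= m -> y <= m -> z <= m ->
    (x + y + z) `^ p <= 3 `^ p * m `^ p.
  move=> m0 xm ym zm; rewrite -powRM//.
  by apply: ge0_ler_powR => //; rewrite ?nnegrE; lra.
have px := powR_ge0 x p; have py := powR_ge0 y p; have pz := powR_ge0 z p.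
have p3 := powR_ge0 3 p.
have [m [m0 xm ym zm mp]] : exists m, [/\ 0 <= m, x <= m, y <= m, z <= m &
    m `^ p <= x `^ p + y `^ p + z `^ p].
  have [xy|yx] := leP x y.
    have [yz|zy] := leP y z; first by exists z; split; lra.
    by exists y; split; lra.
  have [xz|zx] := leP x z; first by exists z; split; lra.
  by exists x; split; lra.
by apply: le_trans (H _ m0 xm ym zm) _; rewrite ler_wpM2l.
Qed.

Definition tail_powR p K a : R := `|a| `^ p * \1_(`]K, +oo[) `|a|.

Lemma tail_powR_ge0 p K a : 0 <= tail_powR p K a.
Proof. by rewrite mulr_ge0 ?powR_ge0. Qed.

Lemma measurable_tail_powR p K : measurable_fun setT (tail_powR p K).
Proof.
apply: measurable_funM.
  by apply: (measurableT_comp (measurable_powR p)); exact: normr_measurable.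
apply: (@measurableT_comp _ _ _ _ _ _ (\1_(`]K, +oo[) : R -> R)) => //.
Qed.

Lemma dist_clamp_powR p K a : 0 < p -> 0 <= K ->
  `|a - clamp K a| `^ p <= tail_powR p K a.
Proof.
move=> p0 K0; have [aK|aK] := leP `|a| K.
  by rewrite clampE// subrr normr0 powR0 ?gt_eqF// tail_powR_ge0.
rewrite /tail_powR indicE mem_set ?mulr1; last by rewrite /= in_itv/= aK.
by rewrite ge0_ler_powR ?nnegrE ?(ltW p0)// dist_clamp.
Qed.

(** The difference is split through the two clamped values. Each truncation error vanishes up to
    level [K] and is at most the absolute value beyond it. *)
Lemma dist_powR_le p K (e : R) a b : 0 < p -> 0 <= K -> 0 <= e ->
  `|clamp K a - clamp K b| <= e ->
  `|a - b| `^ p <= 3 `^ p * (tail_powR p K a + e `^ p + tail_powR p K b).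
Proof.
move=> p0 K0 e0 abe.
apply: (@le_trans _ _ ((`|a - clamp K a| + e + `|b - clamp K b|) `^ p)).
  apply: ge0_ler_powR; rewrite ?nnegrE ?addr_ge0 ?(ltW p0)//.
  rewrite (_ : a - b = (a - clamp K a) + (clamp K a - clamp K b) - (b - clamp K b)); last ring.
  by rewrite (le_trans (ler_normB _ _))// lerD2r (le_trans (ler_normD _ _))// lerD2l.
apply: (le_trans (powR_sum3 _ _ _ _)) => //; first exact: ltW.
by rewrite ler_wpM2l ?powR_ge0// !lerD// dist_clamp_powR.
Qed.

End clamp.

(** * $L^p$ distance between two quantile functions *)

Section quantile_Lp_close.
Context (R : realType) (d : measure_display) (T : measurableType d)
  (P : probability T R) (U : {RV P >-> R}) (U01 : uniform01 U)
  (d' : measure_display) (T' : measurableType d')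
  (P1 P2 : probability T' R) (X1 : {RV P1 >-> R}) (X2 : {RV P2 >-> R})
  (p K h eta tau : R) (m : nat).
Hypotheses (p0 : 0 < p) (K0 : 0 < K) (h0 : 0 < h) (eta0 : 0 <= eta)
  (Km : 2 * K <= m%:R * h)
  (tail1 : (\int[P1]_w (tail_powR p K (X1 w))%:E <= tau%:E)%E)
  (tail2 : (\int[P2]_w (tail_powR p K (X2 w))%:E <= tau%:E)%E).
Let t (j : nat) : R := - K + j%:R * h.
Hypothesis cdf12 : forall j : nat, (j <= m)%N ->
  (cdf X1 (t j) <= cdf X2 (t j + h) + eta%:E)%E.
Hypothesis cdf21 : forall j : nat, (j <= m)%N ->
  (cdf X2 (t j) <= cdf X1 (t j + h) + eta%:E)%E.
Local Notation q1 := (quantile (distribution P1 X1)).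
Local Notation q2 := (quantile (distribution P2 X2)).

(** The levels exceeding a distribution function value at [t j + h] by at most [eta]: only there can
    the slack in [cdf12] or [cdf21] spoil the comparison of quantiles. Since [U] is uniform, each of
    the two intervals has probability at most [eta]. *)
Let bad (j : nat) : set T :=
  U @^-1` `]fine (cdf X1 (t j + h)), fine (cdf X1 (t j + h)) + eta] `|`
  U @^-1` `]fine (cdf X2 (t j + h)), fine (cdf X2 (t j + h)) + eta].
Let B : set T := \big[setU/set0]_(j < m.+1) bad j.

Let measurable_bad j : measurable (bad j).
Proof. by apply: measurableU; exact: measurable_funPTI. Qed.

Let measurable_B : measurable B.
Proof. by apply: bigsetU_measurable => j _. Qed.

Let P_bad j : (P (bad j) <= (2 * eta)%:E)%E.
Proof.
rewrite mulr2n mulrDl mul1r EFinD.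
by rewrite (le_trans (measureU2 _ _ _))//; first exact: measurable_funPTI;
  first exact: measurable_funPTI; rewrite leeD// uniform01_itv.
Qed.

Let P_B : (P B <= (m.+1%:R * (2 * eta))%:E)%E.
Proof.
apply: (le_trans (Boole_inequality _ _)) => //.
apply: (le_trans (lee_sum _ (fun (j : 'I_m.+1) _ => P_bad j))).
by rewrite sumEFin sumr_const card_ord -[_ *+ m.+1]mulr_natl.
Qed.

(* Off the bad events, the almost-inequality between distribution functions
   becomes an inequality between quantile functions. *)
Let transfer d1 (T1 : measurableType d1) (Q1 : probability T1 R)
    d2 (T2 : measurableType d2) (Q2 : probability T2 R)
    (Y : {RV Q1 >-> R}) (Z : {RV Q2 >-> R}) (u s : R) :
  0 < u < 1 -> (cdf Y s <= cdf Z (s + h) + eta%:E)%E ->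
  ~ `]fine (cdf Z (s + h)), fine (cdf Z (s + h)) + eta]%classic u ->
  quantile (distribution Q1 Y) u <= s -> quantile (distribution Q2 Z) u <= s + h.
Proof.
move=> u01 YZ nbad; rewrite !quantile_le// => uY.
have := le_trans uY YZ.
rewrite -[cdf Z _]fineK ?fin_num_measure// -EFinD !lee_fin => uZ.
rewrite leNgt; apply/negP => Zu; apply: nbad.
by rewrite /= in_itv/= Zu.
Qed.

(** On [B] the clamped quantiles differ by at most $2K$. Off [B] they differ by at most $2h$, by
    [clamp_grid] applied in both directions. *)
Let pointwise w : 0 < U w < 1 ->
  `|q1 (U w) - q2 (U w)| `^ p <=
  3 `^ p * (tail_powR p K (q1 (U w)) + ((2 * h) `^ p + (2 * K) `^ p * \1_B w)
            + tail_powR p K (q2 (U w))).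
Proof.
move=> u01.
have h20 : 0 <= (2 * h) `^ p by exact: powR_ge0.
have [wB|wB] := pselect (B w).
  rewrite indicE mem_set// mulr1.
  have K20 : 0 <= 2 * K by rewrite mulr_ge0// ltW.
  apply: le_trans (dist_powR_le p0 (ltW K0) K20 (dist_clamp2 _ _ (ltW K0))) _.
  by rewrite ler_wpM2l ?powR_ge0// lerD2r lerD2l lerDr.
rewrite indicE memNset// mulr0 addr0.
have nbad j : (j <= m)%N -> ~ bad j w.
  by move=> jm bw; apply: wB; rewrite /B -bigcup_mkord; exists j.
apply: dist_powR_le => //; [exact: ltW | by rewrite mulr_ge0// ltW |].
rewrite ler_distl; apply/andP; split.
  rewrite lerBlDr; apply: (clamp_grid _ _ Km) => // j jm; apply: transfer => //.
  - exact: cdf12.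
  - by move=> bw; apply: (nbad _ jm); right.
apply: (clamp_grid _ _ Km) => // j jm; apply: transfer => //.
- exact: cdf21.
- by move=> bw; apply: (nbad _ jm); left.
Qed.

(** The integral of the pointwise bound. The quantile transform turns the tails of $q_i(U)$ into
    those of $X_i$, and the indicator of [B] contributes its probability, bounded by a sum over the
    $m+1$ grid points. *)
Lemma quantile_Lp_close :
  (\int[P]_w (`|q1 (U w) - q2 (U w)| `^ p)%:E <=
   (3 `^ p * (tau + ((2 * h) `^ p + (2 * K) `^ p * (m.+1%:R * (2 * eta)))
              + tau))%:E)%E.
Proof.
have mq1 : measurable_fun setT (q1 \o U) by exact: quantile_RV_measurable.
have mq2 : measurable_fun setT (q2 \o U) by exact: quantile_RV_measurable.
have mt1 : measurable_fun setT (tail_powR p K \o (q1 \o U)).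
  by apply: measurableT_comp => //; exact: measurable_tail_powR.
have mt2 : measurable_fun setT (tail_powR p K \o (q2 \o U)).
  by apply: measurableT_comp => //; exact: measurable_tail_powR.
have mB : measurable_fun setT (\1_B : T -> R) by exact: measurable_indic.
have p30 := powR_ge0 3 p.
have cB0 w : 0 <= (2 * h) `^ p + (2 * K) `^ p * \1_B w.
  by rewrite addr_ge0 ?mulr_ge0 ?powR_ge0.
have mcB : measurable_fun setT (fun w => (2 * h) `^ p + (2 * K) `^ p * \1_B w).
  by apply: measurable_funD => //; exact: measurable_funM.
pose G w := tail_powR p K (q1 (U w)) + ((2 * h) `^ p + (2 * K) `^ p * \1_B w)
            + tail_powR p K (q2 (U w)).
have G0 w : 0 <= G w by apply: addr_ge0; [apply: addr_ge0|]; rewrite ?tail_powR_ge0.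
have mG : measurable_fun setT G by apply: measurable_funD => //; exact: measurable_funD.
apply: (@le_trans _ _ (\int[P]_w (3 `^ p * G w)%:E)%E).
  (* The pointwise bound holds where [U] lies in $]0,1[$, hence almost surely. *)
  apply: ae_ge0_le_integral => //.
  - by apply/measurable_EFinP; apply: (measurableT_comp (measurable_powR p));
      apply: measurableT_comp => //; exact: measurable_funB.
  - by move=> w _; rewrite lee_fin mulr_ge0.
  - by apply/measurable_EFinP; exact: measurable_funM.
  - by apply: filterS (uniform01_ae U01) => w w01 _; rewrite lee_fin pointwise.
under eq_integral do rewrite EFinM.
rewrite ge0_integralZl//; last 2 first.
- by apply/measurable_EFinP.
- by move=> w _; rewrite lee_fin.
rewrite EFinM lee_wpmul2l//.
under eq_integral do rewrite EFinD.
rewrite ge0_integralD//; last 4 first.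
- by move=> w _; rewrite lee_fin addr_ge0 ?tail_powR_ge0.
- by apply/measurable_EFinP; exact: measurable_funD.
- by move=> w _; rewrite lee_fin tail_powR_ge0.
- by apply/measurable_EFinP.
rewrite EFinD leeD//; last first.
  rewrite (quantile_integral U01 X2 (g := fun y => (tail_powR p K y)%:E))//.
  - by apply/measurable_EFinP; exact: measurable_tail_powR.
  - by move=> y; rewrite lee_fin tail_powR_ge0.
under eq_integral do rewrite EFinD.
rewrite ge0_integralD//; last 4 first.
- by move=> w _; rewrite lee_fin tail_powR_ge0.
- by apply/measurable_EFinP.
- by move=> w _; rewrite lee_fin.
- by apply/measurable_EFinP.
rewrite EFinD leeD//.
  rewrite (quantile_integral U01 X1 (g := fun y => (tail_powR p K y)%:E))//.
  - by apply/measurable_EFinP; exact: measurable_tail_powR.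
  - by move=> y; rewrite lee_fin tail_powR_ge0.
under eq_integral do rewrite EFinD.
rewrite ge0_integralD//; last 3 first.
- by move=> w _; rewrite lee_fin powR_ge0.
- by move=> w _; rewrite lee_fin mulr_ge0 ?powR_ge0.
- by apply/measurable_EFinP; exact: measurable_funM.
rewrite EFinD leeD//.
  by rewrite (integral_cst P measurableT) [X in (_ * X)%E]probability_setT mule1.
under eq_integral do rewrite EFinM.
rewrite ge0_integralZl//; last 2 first.
- by apply/measurable_EFinP.
- by rewrite lee_fin powR_ge0.
by rewrite integral_indic// setIT EFinM lee_wpmul2l// lee_fin powR_ge0.
Qed.

End quantile_Lp_close.

(** * Lipschitz sup-convolutions *)

Section sup_convolution.
Context (R : realType) (V W : normedModType R).
Variables (g : V * W -> R) (g01 : forall e, 0 <= g e <= 1) (x : V).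

(** The sup-convolution of [g] with the cone of slope [k], restricted to the slice at [x]. The
    supremum runs over both coordinates, so values of [g] off the slice are taken into account. *)
Definition sup_conv (k : R) (z : W) : R :=
  sup (range (fun e => g e - k * `|e - (x, z)|)).

Let sup_conv_has_sup k z : 0 <= k ->
  has_sup (range (fun e => g e - k * `|e - (x, z)|)).
Proof.
move=> k0; split; first by exists (g (x, z) - k * `|(x, z) - (x, z)|); exists (x, z).
exists 1 => _ [e _ <-]; have /andP[_ ge1] := g01 e.
by rewrite lerBlDr (le_trans ge1)// lerDl mulr_ge0.
Qed.

Lemma sup_conv_le1 k z : 0 <= k -> sup_conv k z <= 1.
Proof.
move=> k0; apply: ge_sup; first exact: (sup_conv_has_sup z k0).1.
move=> _ [e _ <-]; have /andP[_ ge1] := g01 e.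
by rewrite lerBlDr (le_trans ge1)// lerDl mulr_ge0.
Qed.

(** The error in moving from [x] to [x'] is uniform in [z]; this is what lets the first coordinate
    vary under the integral. *)
Lemma sup_conv_ge k z (x' : V) : 0 <= k -> g (x', z) - k * `|x' - x| <= sup_conv k z.
Proof.
move=> k0; apply: ub_le_sup; first exact: (sup_conv_has_sup z k0).2.
exists (x', z) => //; congr (_ - _ * _).
rewrite prod_normE/= subrr normr0; apply/max_idPl; exact: normr_ge0.
Qed.

Lemma sup_conv_ge0 k z : 0 <= k -> 0 <= sup_conv k z.
Proof.
move=> k0; apply: le_trans (sup_conv_ge z x k0).
by rewrite subrr normr0 mulr0 subr0; have /andP[] := g01 (x, z).
Qed.

Lemma sup_conv_lipschitz k z z' : 0 <= k ->
  sup_conv k z <= sup_conv k z' + k * `|z - z'|.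
Proof.
move=> k0; apply: ge_sup; first exact: (sup_conv_has_sup z k0).1.
move=> _ [e _ <-]; rewrite -lerBlDr.
apply: (@le_trans _ _ (g e - k * `|e - (x, z')|)); last first.
  by apply: ub_le_sup; [exact: (sup_conv_has_sup z' k0).2 | exists e].
rewrite -addrA lerD2l -opprD lerN2 -mulrDr ler_wpM2l//.
have -> : `|z - z'| = `|(x, z) - (x, z')|.
  by rewrite prod_normE/= subrr normr0; apply/esym/max_idPr; exact: normr_ge0.
by rewrite (le_trans _ (ler_normD _ _))// addrA subrK.
Qed.

Lemma sup_conv_continuous k : 0 <= k -> continuous (sup_conv k).
Proof.
move=> k0 z; apply/cvgrPdist_lt => e e0; near=> z'.
have h : k * `|z - z'| < e.
  (* The slope is raised to [k + 1] so that it can be divided by even when [k] is 0. *)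
  apply: (@le_lt_trans _ _ ((k + 1) * `|z - z'|)).
    by rewrite ler_wpM2r// lerDl.
  rewrite -ltr_pdivlMl; last by lra.
  near: z'; apply: (@cvgr_dist_lt _ W _ _ _ id z) => //.
  by rewrite mulr_gt0// invr_gt0; lra.
have h1 := sup_conv_lipschitz z z' k0.
have h2 := sup_conv_lipschitz z' z k0.
rewrite distrC in h2.
rewrite ltr_norml; apply/andP; split; lra.
Unshelve. all: by end_near. Qed.

(** Near $(x,z)$ continuity bounds [g] by its value there plus [e]. At distance at least [d] the
    penalty is at least $kd\ge 1$ for large [k], which offsets $g\le 1$. *)
Lemma sup_conv_cvg z : {for (x, z), continuous g} ->
  sup_conv k%:R z @[k --> \oo] --> g (x, z).
Proof.
move=> cg; apply/cvgrPdist_le => e e0.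
have /nbhs_ballP[d /= d0 Hd] : \forall t \near (x, z), `|g (x, z) - g t| <= e.
  by move/cvgrPdist_le : cg; exact.
near=> k.
have k0 : 0 <= k%:R :> R by [].
have h1 := sup_conv_ge z x k0.
rewrite subrr normr0 mulr0 subr0 in h1.
have kd : 1 <= k%:R * d.
  rewrite -ler_pdivrMr//; near: k.
  exact: nbhs_infty_ger.
suff h2 : sup_conv k%:R z <= g (x, z) + e.
  by rewrite ler_norml; lra.
have /andP[g0 g1] := g01 (x, z).
apply: ge_sup; first exact: (sup_conv_has_sup z k0).1.
move=> _ [t _ <-].
have [td|td] := ltP `|t - (x, z)| d.
  have : `|g (x, z) - g t| <= e by apply: Hd; rewrite -ball_normE /= distrC.
  have kt : 0 <= k%:R * `|t - (x, z)| by rewrite mulr_ge0.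
  by rewrite ler_norml; lra.
have /andP[_ gt1] := g01 t.
have : k%:R * d <= k%:R * `|t - (x, z)| by rewrite ler_wpM2l.
lra.
Unshelve. all: by end_near. Qed.

End sup_convolution.

(** * Borel sets, weak convergence, points of continuity and sections *)

Lemma rV_open_measurable (R : realType) (m n : nat) (A : set 'M[R]_(m, n)) :
  open A -> measurable A.
Proof. by move=> oA; exact: sub_sigma_algebra. Qed.

Lemma rV_continuous_measurable (R : realType) (m n : nat) (h : 'M[R]_(m, n) -> R) :
  continuous h -> measurable_fun setT h.
Proof.
move=> /continuousP ch.
apply: (measurability (@RGenOInfty.G R)) => [|/= _ [_] [r] -> <-].
  exact: RGenOInfty.measurableE.
by rewrite setTI; apply: rV_open_measurable; apply: ch; exact: interval_open.
Qed.

Lemma rV_set1_measurable (R : realType) (m n : nat) (x : 'M[R]_(m, n)) :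
  measurable [set x].
Proof.
rewrite -(setCK [set x]); apply: measurableC; apply: rV_open_measurable.
apply: closed_openC; apply: accessible_closed_set1; apply: hausdorff_accessible.
exact: norm_hausdorff.
Qed.

(** The weak topology is a supremum of initial topologies, one of which is that of integration
    against [h]. *)
Lemma weak_continuous (R : realType) (n : nat) (h : 'rV[R]_n -> R)
    (nu : probability 'rV[R]_n R) : continuous h -> bounded_fun h ->
  (fun mu : probability 'rV[R]_n R => \int[mu]_z h z) @ nbhs nu -->
  (\int[nu]_z h z).
Proof.
move=> ch bh.
pose H : bounded_continuous R n := exist _ h (conj ch bh).
have /cvg_sup/(_ H) cH : nbhs nu --> nu by exact: cvg_id.
move=> A nA; apply: cH.
exact: (@initial_continuous _ _ (fun mu : probability 'rV[R]_n R => \int[mu]_z h z) nu).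
Qed.

Section continuity_set.
Context (R : realType) (T : topologicalType) (f : T -> R).

Let O (k : nat) : set T :=
  \bigcup_(W in [set W : set T | open W /\ forall a b, W a -> W b ->
     `|f a - f b| < k.+1%:R^-1]) W.

(** Continuity means zero oscillation, and [O k] collects the open sets on which [f] varies by less
    than $1/(k+1)$. *)
Lemma continuity_set_Gdelta :
  [set t | {for t, continuous f}] = \bigcap_k O k.
Proof.
apply/seteqP; split=> [t /cvgrPdist_lt ct k _|t Ot].
  have /ct : 0 < (k.+1%:R^-1 / 2 : R) by [].
  rewrite nbhsE => -[W [oW Wt] HW]; exists W => //; split=> // a b /HW /= ha /HW /= hb.
  rewrite (_ : f a - f b = (f t - f b) - (f t - f a)); last ring.
  by rewrite [ltRHS]splitr (le_lt_trans (ler_normB _ _))// ltrD.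
apply/cvgrPdist_lt => e e0.
have [W [oW HW] Wt] := Ot (Num.truncn e^-1) I.
apply: filterS (open_nbhs_nbhs (conj oW Wt)) => a Wa.
apply: (lt_trans (HW _ _ Wt Wa)); rewrite -[ltRHS]invrK ltf_pV2 ?posrE ?invr_gt0//.
exact: Num.Theory.truncnS_gt.
Qed.

Lemma continuity_set_open k : open (O k).
Proof. by apply: bigcup_open => W []. Qed.

End continuity_set.

Section null_discontinuity.
Import HBNNSimple.
Context (R : realType) (n s : nat) (f : 'rV[R]_n * 'rV[R]_s -> R)
  (x : 'rV[R]_n) (nu : probability 'rV[R]_s R).

(** The complement of the section is the preimage of a $G_\delta$ set under the continuous map
    $z\mapsto(x,z)$, hence a countable intersection of open sets. *)
Lemma measurable_xsection_discontinuity :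
  measurable (xsection (discontinuity_points f) x).
Proof.
have -> : xsection (discontinuity_points f) x =
    ~` [set z | {for (x, z), continuous f}].
  by apply/seteqP; split=> z /=; rewrite /xsection/= inE.
apply: measurableC.
rewrite (_ : [set _ | _] = (pair x) @^-1` [set t | {for t, continuous f}])//.
rewrite continuity_set_Gdelta preimage_bigcap; apply: bigcap_measurable => // k _.
have /continuousP cx : continuous (pair x : 'rV[R]_s -> 'rV[R]_n * 'rV[R]_s).
  move=> z A [[B C] [/= nB nC] BC]; apply: filterS nC => w Cw.
  by apply: BC; split => //; exact: nbhs_singleton nB.
apply: rV_open_measurable; apply: cx.
exact: continuity_set_open.
Qed.

(* [D] need not be measurable: the integral defining the product measure is a
   supremum over simple functions, and a multiple of the indicator of [x] is one. *)
Lemma dirac_product_null (D : set ('rV[R]_n * 'rV[R]_s)) :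
  (\d_x \x nu)%E D = 0%E -> nu (xsection D x) = 0%E.
Proof.
rewrite /product_measure1 ge0_integralTE// => H0.
apply/eqP; rewrite eq_le measure_ge0 andbT leNgt; apply/negP => pos.
(* The section of [D] may be non-measurable and its value under [nu] infinite; any positive real
   below that value serves. *)
have [r [r0 rle]] : exists r : R, 0 < r /\ (r%:E <= nu (xsection D x))%E.
  move: pos; case: (nu _) => [r||]//; first by rewrite lte_fin => r0; exists r.
  by move=> _; exists 1; rewrite leey.
have mx := rV_set1_measurable x.
have rN : 0 <= r by exact: ltW.
pose h : {nnsfun 'rV[R]_n >-> R} := scale_nnsfun (indic_nnsfun R mx) rN.
have : (sintegral (\d_x : {measure set 'rV[R]_n -> \bar R}) h <= 0)%E.
  rewrite -H0; apply: ereal_sup_ubound; exists h => //= y.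
  rewrite -[mindic R mx y]/(\1_[set x] y).
  have [->|yx] := eqVneq y x; first by rewrite indicE mem_set//= mulr1.
  rewrite indicE memNset/= ?mulr0; first exact: measure_ge0.
  by apply/eqP.
rewrite -integralT_nnsfun integral_dirac//; last first.
  by apply/measurable_EFinP.
rewrite diracE mem_set// mul1e /= -[mindic R mx x]/(\1_[set x] x).
by rewrite indicE mem_set//= mulr1 lee_fin leNgt r0.
Qed.

Lemma ae_continuity : (\d_x \x nu)%E (discontinuity_points f) = 0%E ->
  {ae nu, forall z, {for (x, z), continuous f}}.
Proof.
move=> /dirac_product_null H; exists (xsection (discontinuity_points f) x); split => //.
  exact: measurable_xsection_discontinuity.
by move=> z /= h; rewrite /xsection/= inE.
Qed.

End null_discontinuity.

Section dirac_product.
Context (R : realType) (n s : nat) (x : 'rV[R]_n) (mu : probability 'rV[R]_s R).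

Lemma integral_dirac_product (h : 'rV[R]_n * 'rV[R]_s -> \bar R) :
  measurable_fun setT h -> (forall e, 0 <= h e)%E ->
  (\int[\d_x \x mu]_e h e = \int[mu]_z h (x, z))%E.
Proof.
move=> mh h0; rewrite fubini_tonelli1// integral_dirac//.
  by rewrite diracE mem_set// mul1e.
exact: measurable_fun_fubini_tonelli_F.
Qed.

End dirac_product.

(** * Semicontinuity of integrals and control of distribution functions *)

Section ramp.
Context (R : realType).

(** For $h>0$, the piecewise affine function equal to 1 up to $t$ and to 0 from $t+h$ on. *)
Definition ramp (t h y : R) : R := Num.max 0 (Num.min 1 ((t + h - y) / h)).

Lemma ramp01 t h y : 0 <= ramp t h y <= 1.
Proof. by rewrite /ramp le_max lexx ge_max ler01 ge_min lexx. Qed.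

Lemma ramp_continuous t h : continuous (ramp t h).
Proof.
move=> y.
have cst_cont c : {for y, continuous (fun=> c : R^o)} by exact: cvg_cst.
have lin_cont : {for y, continuous (fun y => (t + h - y) / h : R^o)}.
  by apply: cvgM; [apply: cvgB; [exact: cvg_cst | exact: cvg_id] | exact: cvg_cst].
exact: (continuous_max (cst_cont 0) (continuous_min (cst_cont 1) lin_cont)).
Qed.

Lemma ramp_ge t h y : 0 < h -> \1_(`]-oo, t]) y <= ramp t h y.
Proof.
move=> h0; rewrite indicE; case: (boolP (y \in _)) => [|_].
  rewrite inE/= in_itv/= => yt; rewrite /ramp le_max le_min lexx/=.
  by apply/orP; right; rewrite ler_pdivlMr// mul1r; lra.
by have /andP[] := ramp01 t h y.
Qed.

Lemma ramp_le t h y : 0 < h -> ramp t h y <= \1_(`]-oo, t + h]) y.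
Proof.
move=> h0; rewrite indicE; case: (boolP (y \in _)) => [_|].
  by have /andP[] := ramp01 t h y.
rewrite notin_setE/= in_itv/= => /negP; rewrite -ltNge => ty.
by rewrite /ramp ge_max lexx/= ge_min; apply/orP; right;
  rewrite ler_pdivrMr// mul0r; lra.
Qed.

End ramp.

Section continuous_mapping.
Context (R : realType) (n s : nat) (x : 'rV[R]_n) (nu : probability 'rV[R]_s R).

(** Three errors of [eps / 3]: dominated convergence fixes [k] with the integral of [G k] under [nu]
    close to that of $g(x,\cdot)$; weak continuity then handles the change from [nu] to [mu]; and
    $k\|x'-x\|$ handles the change of the first coordinate. *)
Lemma weak_usc (g : 'rV[R]_n * 'rV[R]_s -> R) (eps : R) :
  measurable_fun setT g -> (forall e, 0 <= g e <= 1) ->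
  {ae nu, forall z, {for (x, z), continuous g}} -> 0 < eps ->
  filter_prod (nbhs x) (nbhs nu) [set t : 'rV[R]_n * probability 'rV[R]_s R |
    (\int[t.2]_z (g (t.1, z))%:E <= \int[nu]_z (g (x, z))%:E + eps%:E)%E].
Proof.
move=> mg g01 cg e0.
pose G (k : nat) : 'rV[R]_s -> R := sup_conv g x k%:R.
have k0 k : 0 <= k%:R :> R by [].
have cG k : continuous (G k) by exact: sup_conv_continuous.
have mG k : measurable_fun setT (EFin \o G k).
  by apply/measurable_EFinP; exact: rV_continuous_measurable.
have mgx x' : measurable_fun setT (fun z => (g (x', z))%:E).
  by apply/measurable_EFinP; exact: (measurableT_comp mg (pair1_measurable x')).
have G0 k z : 0 <= G k z by exact: sup_conv_ge0.
have G1 k z : G k z <= 1 by exact: sup_conv_le1.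
have int1 (mu : probability 'rV[R]_s R) : mu.-integrable setT (cst 1%E).
  exact: (finite_measure_integrable_cst mu 1).
have iG k (mu : probability 'rV[R]_s R) : mu.-integrable setT (EFin \o G k).
  apply: le_integrable (int1 mu) => //= z _.
  by rewrite lee_fin normr1 ger0_norm.
have [_ _ cvgG] : [/\ nu.-integrable setT (fun z => (g (x, z))%:E),
    (\int[nu]_z `|(EFin \o G k) z - (g (x, z))%:E|)%E @[k --> \oo] --> 0%E &
    (\int[nu]_z (EFin \o G k) z)%E @[k --> \oo] --> (\int[nu]_z (g (x, z))%:E)%E].
  apply: (@dominated_convergence _ _ _ nu setT measurableT (fun k => EFin \o G k)
    (fun z => (g (x, z))%:E) (cst 1%E)) => //.
  - apply: filterS cg => z cgz _.
    by apply: cvg_EFin; [exact: nearW | exact: sup_conv_cvg].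
  - exact: int1.
  - by apply: aeW => z k _; rewrite /= lee_fin ger0_norm.
have fing (mu : probability 'rV[R]_s R) x' :
    (\int[mu]_z (g (x', z))%:E)%E \is a fin_num.
  apply: integrable_fin_num => //; apply: le_integrable (int1 mu) => //= z _.
  by rewrite lee_fin normr1 ger0_norm; have /andP[] := g01 (x', z).
have e3 : 0 < eps / 3 by rewrite divr_gt0.
have [k Hk] : exists k, (\int[nu]_z (G k z)%:E <
    \int[nu]_z (g (x, z))%:E + (eps / 3)%:E)%E.
  have : \forall k \near \oo, (\int[nu]_z (G k z)%:E <
      \int[nu]_z (g (x, z))%:E + (eps / 3)%:E)%E.
    apply: (cvgG [set y | (y < _)%E]); apply: open_nbhs_nbhs; split.
      exact: open_ereal_lt_ereal.
    by rewrite /= lteDl.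
  by move=> [k _ /(_ k (leqnn k))]; exists k.
have bG : bounded_fun (G k).
  exists 1; split => // M M1 z _ /=; rewrite ger0_norm//.
  by rewrite (le_trans (G1 _ _))// ltW.
have /cvgrPdist_lt/(_ _ e3) near_mu := weak_continuous (nu := nu) (cG k) bG.
have near_x : \forall x' \near x, k%:R * `|x' - x| <= eps / 3.
  near=> x'; apply: (@le_trans _ _ ((k%:R + 1) * `|x' - x|)).
    by rewrite ler_wpM2r// lerDl.
  rewrite -ler_pdivlMl; last by rewrite ltr_wpDl.
  rewrite distrC ltW//; near: x'; apply: (@cvgr_dist_lt _ _ _ _ _ id x) => //.
  by rewrite mulr_gt0// invr_gt0 ltr_wpDl.
exists ([set x' | k%:R * `|x' - x| <= eps / 3],
  [set mu : probability 'rV[R]_s R |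
    `|\int[nu]_z G k z - \int[mu]_z G k z| < eps / 3]); first by split.
move=> [x' mu] /= [hx hmu].
have h1 : (\int[mu]_z (g (x', z))%:E <= \int[mu]_z ((G k z)%:E + (eps / 3)%:E))%E.
  apply: ge0_le_integral => //.
  - by move=> z _; rewrite lee_fin; have /andP[] := g01 (x', z).
  - by apply: emeasurable_funD; [exact: mG | exact: measurable_cst].
  - move=> z _; rewrite -EFinD lee_fin.
    by have := @sup_conv_ge _ _ _ _ g01 x _ z x' (k0 k); rewrite -/(G k); lra.
apply: (le_trans h1).
have RE (nu' : probability 'rV[R]_s R) :
    (\int[nu']_z (G k z)%:E = (\int[nu']_z G k z)%:E)%E.
  by rewrite /Rintegral fineK// integrable_fin_num//; exact: iG.
rewrite integralD//; last 2 first.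
- exact: iG.
- exact: (finite_measure_integrable_cst mu (eps / 3)).
rewrite (integral_cst mu measurableT) [X in (_ * X)%E]probability_setT mule1.
move: Hk; rewrite !RE -[(\int[nu]_z (g (x, z))%:E)%E]fineK//.
rewrite -!EFinD lte_fin lee_fin => Hk.
move: hmu; rewrite ltr_norml => /andP[hmu1 hmu2].
move: Hk hmu1 hmu2.
move: (Rintegral _ _ _) (Rintegral _ _ _) (fine _) => a b c; lra.
Unshelve. all: by end_near. Qed.

Variable f : {mfun ('rV[R]_n * 'rV[R]_s)%type >-> R}.
Local Notation cdf_f x mu := (@cdf _ _ R (\d_x \x mu)%E f).

Lemma cdf_integral (x' : 'rV[R]_n) (mu : probability 'rV[R]_s R) t :
  (cdf_f x' mu t = \int[mu]_z (\1_(`]-oo, t]) (f (x', z)))%:E)%E.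
Proof.
rewrite -[LHS]/((\d_x' \x mu)%E (f @^-1` `]-oo, t]%classic)).
have mA : measurable (f @^-1` `]-oo, t]%classic) by exact: measurable_funPTI.
transitivity (\int[(\d_x' \x mu)%E]_e (\1_(f @^-1` `]-oo, t]) e)%:E)%E.
  by rewrite integral_indic// setIT.
apply: (@integral_dirac_product _ _ _ x' mu
  (fun e => (\1_(f @^-1` `]-oo, t]) e)%:E)) => [|e]; last by rewrite lee_fin.
by apply/measurable_EFinP; exact: measurable_indic.
Qed.

Let mf (x' : 'rV[R]_n) (h : R -> R) : measurable_fun setT h ->
  measurable_fun setT (fun z => (h (f (x', z)))%:E).
Proof.
move=> mh; apply/measurable_EFinP; apply: (measurableT_comp mh).
by apply: measurableT_comp => //; exact: pair1_measurable.
Qed.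

Let mramp t h : measurable_fun setT (@ramp R t h).
Proof. by apply: continuous_measurable_fun => y; exact: ramp_continuous. Qed.

Lemma cdf_le_ramp (x' : 'rV[R]_n) (mu : probability 'rV[R]_s R) t h : 0 < h ->
  (cdf_f x' mu t <= \int[mu]_z (ramp t h (f (x', z)))%:E)%E.
Proof.
move=> h0; rewrite cdf_integral; apply: ge0_le_integral => //.
- by apply: (@mf x' (\1_(`]-oo, _]%classic))); exact: measurable_indic.
- exact: (mf _ (mramp t h)).
- by move=> z _; rewrite lee_fin ramp_ge.
Qed.

Lemma ramp_le_cdf (x' : 'rV[R]_n) (mu : probability 'rV[R]_s R) t h : 0 < h ->
  (\int[mu]_z (ramp t h (f (x', z)))%:E <= cdf_f x' mu (t + h))%E.
Proof.
move=> h0; rewrite cdf_integral; apply: ge0_le_integral => //.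
- by move=> z _; rewrite lee_fin; have /andP[] := ramp01 t h (f (x', z)).
- exact: (mf _ (mramp t h)).
- by apply: (@mf x' (\1_(`]-oo, _]%classic))); exact: measurable_indic.
- by move=> z _; rewrite lee_fin ramp_le.
Qed.

(** The ramp lies between the indicators of $]-\infty,t]$ and $]-\infty,t+h]$. Upper semicontinuity
    for the ramp composed with [f] gives the first inequality, and for 1 minus that composition the
    second. *)
Lemma near_cdf t h eta : {ae nu, forall z, {for (x, z), continuous f}} ->
  0 < h -> 0 < eta ->
  filter_prod (nbhs x) (nbhs nu) [set e : 'rV[R]_n * probability 'rV[R]_s R |
    (cdf_f e.1 e.2 t <= cdf_f x nu (t + h) + eta%:E)%E /\
    (cdf_f x nu t <= cdf_f e.1 e.2 (t + h) + eta%:E)%E].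
Proof.
move=> cf h0 eta0.
have r01 y : 0 <= ramp t h y <= 1 by exact: ramp01.
have mr : measurable_fun setT (fun e => ramp t h (f e)) by exact: measurableT_comp.
have cr : {ae nu, forall z, {for (x, z), continuous (fun e => ramp t h (f e))}}.
  apply: filterS cf => z cfz.
  by apply: (@continuous_comp _ _ _ f (ramp t h)) => //; exact: ramp_continuous.
have h1 := weak_usc mr (fun e => r01 (f e)) cr eta0.
have h2 : filter_prod (nbhs x) (nbhs nu) [set e : 'rV[R]_n * probability 'rV[R]_s R |
    (\int[e.2]_z (1 - ramp t h (f (e.1, z)))%:E <=
     \int[nu]_z (1 - ramp t h (f (x, z)))%:E + eta%:E)%E].
  apply: (@weak_usc (fun e => 1 - ramp t h (f e))) => //.
  - exact: measurable_funB.
  - by move=> e; have := r01 (f e); lra.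
  - by apply: filterS cr => z crz; apply: cvgB => //; exact: cvg_cst.
apply: filterS2 h1 h2 => -[x' mu] /= h1 h2; split.
  exact: le_trans (cdf_le_ramp x' mu t h0) (le_trans h1 (leeD (ramp_le_cdf x nu t h0) _)).
have ir (m : probability 'rV[R]_s R) y :
    m.-integrable setT (fun z => (ramp t h (f (y, z)))%:E).
  apply: le_integrable (finite_measure_integrable_cst m 1 measurableT) => //=.
    exact: (mf _ (mramp t h)).
  by move=> z _; rewrite lee_fin normr1 ger0_norm; have /andP[] := r01 (f (y, z)).
have I1 (m : probability 'rV[R]_s R) y : (\int[m]_z (1 - ramp t h (f (y, z)))%:E
    = 1 - \int[m]_z (ramp t h (f (y, z)))%:E)%E.
  under eq_integral do rewrite EFinB.
  rewrite (integralB measurableT (finite_measure_integrable_cst m 1 measurableT) (ir m y)).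
  by rewrite /= (integral_cst m measurableT) [X in (_ * X)%E]probability_setT mule1.
apply: (le_trans (cdf_le_ramp x nu t h0)).
apply: (le_trans _ (leeD (ramp_le_cdf x' mu t h0) (lexx _))).
move: h2; rewrite !I1.
have := integrable_fin_num measurableT (ir nu x).
have := integrable_fin_num measurableT (ir mu x').
case: (integral _ _ _) => // a _; case: (integral _ _ _) => // b _ ba.
move: ba.
by rewrite -?EFinB -?EFinD !lee_fin; lra.
Qed.

End continuous_mapping.

(** * Uniform integrability at a fixed level *)

Lemma enorm_ge0 (R : realType) (n : nat) (z : 'rV[R]_n) : 0 <= enorm z.
Proof. exact: sqrtr_ge0. Qed.

Lemma enorm_measurable (R : realType) (n : nat) :
  measurable_fun setT (@enorm R n).
Proof.
apply: (@measurableT_comp _ _ _ _ _ _ (@Num.sqrt R) setT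
  (fun z : 'rV[R]_n => \sum_(i < n) z 0 i ^+ 2)).
  by apply: continuous_measurable_fun; exact: sqrt_continuous.
apply: measurable_sum => i; apply: measurable_funX.
by apply: rV_continuous_measurable; exact: coord_continuous.
Qed.

(** The tail supremum is nonincreasing in the level, so its limit is an infimum. A limit at most
    [eps / 2] leaves room for a strict inequality, from which a single level [a] is extracted. *)
Lemma uniform_integrating_tail_le (R : realType) (n : nat) (q : R)
    (M : set (probability 'rV[R]_n R)) (nu : probability 'rV[R]_n R) (eps : R) :
  locally_uniformly_integrating q M -> M nu -> 0 < eps ->
  exists a : R, within M (nbhs nu) [set mu : probability 'rV[R]_n R |
    (\int[mu]_z ((enorm z `^ q * \1_(`]a, +oo[) (enorm z `^ q))%:E) <= eps%:E)%E].
Proof.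
move=> HM Mnu e0; have e2 : 0 < eps / 2 by rewrite divr_gt0.
have [L [oL Lnu]] := HM _ e2 _ Mnu.
pose t (a : R) (mu : probability 'rV[R]_n R) :=
  (\int[mu]_z ((enorm z `^ q * \1_(`]a, +oo[) (enorm z `^ q))%:E))%E.
pose S (a : R) := ereal_sup [set t a mu | mu in L `&` M].
have mq : measurable_fun setT (fun z : 'rV[R]_n => enorm z `^ q).
  by apply: (measurableT_comp (measurable_powR q)); exact: enorm_measurable.
have mt a : measurable_fun setT (fun z : 'rV[R]_n =>
    (enorm z `^ q * \1_(`]a, +oo[) (enorm z `^ q))%:E).
  apply/measurable_EFinP; apply: measurable_funM => //.
  by apply: (@measurableT_comp _ _ _ _ _ _ (\1_(`]a, +oo[) : R -> R)) => //.
have S_ni : {homo S : a b / (a <= b)%R >-> (b <= a)%E}.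
  move=> a b ab; apply: ge_ereal_sup => _ [mu Lmu <-].
  apply: (@le_trans _ _ (t a mu)); last by apply: ereal_sup_ubound; exists mu.
  apply: ge0_le_integral => //.
    by move=> z _; rewrite lee_fin mulr_ge0 ?powR_ge0.
  move=> z _; rewrite lee_fin ler_wpM2l ?powR_ge0// !indicE ler_nat.
  case: (boolP (_ \in `]b, +oo[%classic)) => // zb; rewrite mem_set//.
  by move: zb; rewrite inE/= !in_itv/= !andbT; exact: le_lt_trans.
have -> : (lim (S a @[a --> +oo%R]) = ereal_inf (range S))%E.
  by apply: cvg_lim => //; exact: nonincreasing_cvge.
move=> hS; have : (ereal_inf (range S) < eps%:E)%E.
  by apply: (le_lt_trans hS); rewrite lte_fin; lra.
move=> /ereal_inf_lt[_ [a _ <-] Sa]; exists a.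
have nL : nbhs nu L by apply: open_nbhs_nbhs.
rewrite /within /=; apply: filterS nL => mu Lmu Mmu.
by apply: le_trans (ltW Sa); apply: ereal_sup_ubound; exists mu.
Qed.

(** * Joint continuity of the objective *)

Section objective_continuity.
Context (R : realType) (p : R) (p1 : (1 <= p%:E)%E)
  (d : measure_display) (T : measurableType d) (P : probability T R)
  (U : {RV P >-> R}) (U01 : uniform01 U)
  (rho : LfunType P p1 -> R)
  (rho_convex : convex_function setT rho)
  (rho_nondecreasing : ae_nondecreasing rho)
  (n s : nat)
  (f : {mfun ('rV[R]_n * 'rV[R]_s)%type >-> R})
  (gamma : R) (f_limited : limited_by gamma f)
  (M : set (probability 'rV[R]_s R))
  (M_moment : M `<=` finite_moment (gamma * p))
  (M_integrating : locally_uniformly_integrating (gamma * p) M).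

Let p_ge1 : 1 <= p. Proof. by move: p1; rewrite lee_fin. Qed.
Let p0 : 0 < p. Proof. exact: lt_le_trans p_ge1. Qed.

Let mq : measurable_fun setT (fun z : 'rV[R]_s => enorm z `^ (gamma * p)).
Proof. by apply: (measurableT_comp (measurable_powR _)); exact: enorm_measurable. Qed.

(** Ensures that [insubd] in [Rrho] returns the quantile function and not the default 0. With
    $a=\|z\|^\gamma$, the bound $a+1\le 2\max(a,1)$ gives $|f(x,z)|^p\le(2\eta(x))^p(a^p+1)$, which
    is integrable by the moment condition. *)
Lemma quantile_Lfun (x : 'rV[R]_n) (mu : probability 'rV[R]_s R) : M mu ->
  quantile (distribution (\d_x \x mu)%E f) \o U \in Lfun P p%:E.
Proof.
move=> Mmu; apply: Lfun_of_integral_lty => //; first exact: quantile_RV_measurable.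
have mpow : measurable_fun setT (fun y : R => (`|y| `^ p)%:E).
  by apply/measurable_EFinP; apply: (measurableT_comp (measurable_powR p)).
rewrite (quantile_integral U01 (f : {RV (\d_x \x mu)%E >-> R})
  (g := fun y => (`|y| `^ p)%:E))//.
rewrite (@integral_dirac_product _ _ _ x mu (fun e => (`|f e| `^ p)%:E)); last 2 first.
- exact: (measurableT_comp mpow).
- by move=> e; rewrite lee_fin powR_ge0.
have [eta [eta0 _ Hf]] := f_limited.
have c0 : 0 <= (2 * eta x) `^ p by exact: powR_ge0.
apply: (@le_lt_trans _ _ (\int[mu]_z (((2 * eta x) `^ p)%:E *
    ((enorm z `^ (gamma * p))%:E + 1%:E))))%E.
  apply: ge0_le_integral => //.
  - apply: (measurableT_comp mpow); exact: measurableT_comp.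
  - apply: emeasurable_funM => //; apply: emeasurable_funD => //.
    exact/measurable_EFinP.
  move=> z _; rewrite -EFinD -EFinM lee_fin.
  pose a := enorm z `^ gamma.
  have a0 : 0 <= a by exact: powR_ge0.
  have aE : enorm z `^ (gamma * p) = a `^ p by rewrite powRrM.
  have fa : `|f (x, z)| <= eta x * (a + 1) := Hf x z.
  have e0 := eta0 x.
  rewrite aE; have [a1|a1] := leP a 1.
    apply: (@le_trans _ _ ((2 * eta x) `^ p)); last first.
      by rewrite ler_peMr// lerDr powR_ge0.
    apply: ge0_ler_powR; rewrite ?nnegrE ?(ltW p0)//; first by rewrite mulr_ge0// ltW.
    by apply: (le_trans fa); nra.
  apply: (@le_trans _ _ ((2 * eta x * a) `^ p)).
    apply: ge0_ler_powR; rewrite ?nnegrE ?(ltW p0)//; first by rewrite !mulr_ge0// ltW.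
    by apply: (le_trans fa); nra.
  by rewrite powRM//; [rewrite ler_wpM2l// lerDl | rewrite mulr_ge0// ltW].
rewrite ge0_integralZl//; last 2 first.
- by apply: emeasurable_funD => //; exact/measurable_EFinP.
- by move=> z _; rewrite -EFinD lee_fin addr_ge0// powR_ge0.
rewrite ge0_integralD//; last 2 first.
- by move=> z _; rewrite lee_fin powR_ge0.
- exact/measurable_EFinP.
rewrite (integral_cst mu measurableT) [X in (_ + _ * X)%E]probability_setT mule1.
rewrite lte_mul_pinfty// lte_add_pinfty ?ltry//.
exact: M_moment.
Qed.

(* If [|f (x', z)| > 2 C b] with [|f (x', z)| <= C (a + 1)], [a = enorm z `^ gamma]
   and [b >= 1], then [a > b], hence [|f (x', z)| <= 2 C a]. *)
Lemma near_tail_powR (x : 'rV[R]_n) (nu : probability 'rV[R]_s R) (tau : R) :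
  M nu -> 0 < tau -> exists2 K : R, 0 < K &
  filter_prod (nbhs x) (within M (nbhs nu))
    [set e : 'rV[R]_n * probability 'rV[R]_s R |
      (\int[(\d_(e.1) \x e.2)%E]_y (tail_powR p K (f y))%:E <= tau%:E)%E].
Proof.
move=> Mnu tau0.
have [eta [eta0 Heta Hf]] := f_limited.
have [C C0 HC] : exists2 C : R, 0 < C & \forall x' \near x, eta x' <= C.
  have [B [_ HB]] := Heta x.
  exists (Num.max 1 (B + 1)); first by rewrite lt_max ltr01.
  have /HB : B < Num.max 1 (B + 1) by rewrite lt_max ltrDl ltr01 orbT.
  by apply: filterS => x'; exact: le_trans (ler_norm _).
have C2 : 0 < 2 * C by rewrite mulr_gt0.
have c0 : 0 < (2 * C) `^ p by exact: powR_gt0.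
(* The tolerance is divided by $(2C)^p$ because on the tail $|f(x',z)|^p$ is at most
   $(2C)^p\|z\|^{\gamma p}$. *)
have [A HA] := uniform_integrating_tail_le M_integrating Mnu (divr_gt0 tau0 c0).
(* Both $b\ge 1$ and $b^p\ge A$ are wanted; the maximum achieves them since $p\ge 1$. *)
pose b := Num.max 1 A.
have b1 : 1 <= b by rewrite le_max lexx.
have bA : A <= b `^ p.
  apply: (@le_trans _ _ b); first by rewrite le_max lexx orbT.
  by rewrite -[leLHS]powRr1 ?(le_trans ler01)// ler_powR.
exists (2 * C * b); first by rewrite mulr_gt0// (lt_le_trans ltr01).
exists ([set x' | eta x' <= C], [set mu : probability 'rV[R]_s R |
  (\int[mu]_z ((enorm z `^ (gamma * p) *
      \1_(`]A, +oo[) (enorm z `^ (gamma * p)))%:E) <= (tau / (2 * C) `^ p)%:E)%E]).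
  by split.
move=> [x' mu] /= [etaC Hmu].
rewrite (@integral_dirac_product _ _ _ x' mu
  (fun y => (tail_powR p (2 * C * b) (f y))%:E)); last 2 first.
- apply/measurable_EFinP; apply: measurableT_comp => //.
  exact: measurable_tail_powR.
- by move=> e; rewrite lee_fin tail_powR_ge0.
have mind : measurable_fun setT (fun z : 'rV[R]_s =>
    enorm z `^ (gamma * p) * \1_(`]A, +oo[) (enorm z `^ (gamma * p))).
  apply: measurable_funM => //.
  by apply: (@measurableT_comp _ _ _ _ _ _ (\1_(`]A, +oo[) : R -> R)).
apply: (@le_trans _ _ (((2 * C) `^ p)%:E * \int[mu]_z ((enorm z `^ (gamma * p) *
      \1_(`]A, +oo[) (enorm z `^ (gamma * p)))%:E))%E); last first.
  apply: (@le_trans _ _ (((2 * C) `^ p)%:E * (tau / (2 * C) `^ p)%:E)%E).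
    by rewrite lee_wpmul2l// lee_fin ltW.
  by rewrite -EFinM mulrC divfK// gt_eqF.
rewrite -ge0_integralZl//; last 3 first.
- exact/measurable_EFinP.
- by move=> z _; rewrite lee_fin mulr_ge0 ?powR_ge0.
- by rewrite lee_fin ltW.
apply: ge0_le_integral => //.
- by move=> z _; rewrite lee_fin tail_powR_ge0.
- apply/measurable_EFinP; apply: (measurableT_comp (measurable_tail_powR _ _)).
  exact: measurableT_comp.
- by apply: emeasurable_funM => //; exact/measurable_EFinP.
move=> z _; rewrite -EFinM lee_fin /tail_powR indicE.
case: (boolP (_ \in `]_, +oo[%classic)) => [|_]; last first.
  by rewrite mulr0 !mulr_ge0 ?powR_ge0.
rewrite inE/= in_itv/= andbT => fK; rewrite mulr1.
pose a := enorm z `^ gamma.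
have aE : enorm z `^ (gamma * p) = a `^ p by rewrite powRrM.
have fa : `|f (x', z)| <= eta x' * (a + 1) := Hf x' z.
have a0 : 0 <= a by exact: powR_ge0.
have ab : b < a.
  have h : 2 * C * b < C * (a + 1).
    by apply: (lt_le_trans fK); apply: (le_trans fa); rewrite ler_wpM2r//; lra.
  by move: h; rewrite [2 * C]mulrC -mulrA ltr_pM2l//; lra.
have a1 : 1 < a by exact: le_lt_trans ab.
rewrite aE indicE mem_set ?mulr1; last first.
  rewrite /= in_itv/= andbT; apply: (le_lt_trans bA).
  by apply: gt0_ltr_powR => //; rewrite nnegrE (le_trans ler01)// ltW.
rewrite -powRM ?(ltW C2)//; apply: ge0_ler_powR; rewrite ?nnegrE ?(ltW p0)//.
  by rewrite mulr_ge0// ltW.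
by apply: (le_trans fa); nra.
Qed.

Lemma filter_prod_within_point (x : 'rV[R]_n) (nu : probability 'rV[R]_s R) A :
  M nu -> filter_prod (nbhs x) (within M (nbhs nu)) A -> A (x, nu).
Proof.
move=> Mnu [[B C] /= [nB nC] BC]; apply: BC; split; first exact: nbhs_singleton nB.
exact: (nbhs_singleton nC).
Qed.

Lemma filter_prod_within (x : 'rV[R]_n) (nu : probability 'rV[R]_s R) A :
  filter_prod (nbhs x) (nbhs nu) A -> filter_prod (nbhs x) (within M (nbhs nu)) A.
Proof.
move=> [[B C] /= [nB nC] BC]; exists (B, C) => //; split => //.
exact: cvg_within nC.
Qed.

(** In the estimate of [quantile_Lp_close], the two tails are at most [tau] by the choice of [K],
    and [h] and [eta] make the grid term and the bad-event term equal to [tau]. With [tau] equal to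
    $\delta/(8\cdot 3^p)$ the total is $\delta/2$, within the radius $\delta$ of continuity of
    [rho]. *)
Lemma Qfun_continuous (x : 'rV[R]_n) (nu : probability 'rV[R]_s R) (eps : R) :
  M nu -> (\d_x \x nu)%E (discontinuity_points f) = 0%E -> 0 < eps ->
  filter_prod (nbhs x) (within M (nbhs nu))
    [set e : 'rV[R]_n * probability 'rV[R]_s R |
      `|Qfun rho U f e.1 e.2 - Qfun rho U f x nu| < eps].
Proof.
move=> Mnu /ae_continuity cf eps0.
pose q (y : 'rV[R]_n) (mu : probability 'rV[R]_s R) := quantile (distribution (\d_y \x mu)%E f) \o U.
pose Z y mu : LfunType P p1 := insubd (0 : LfunType P p1) (q y mu).
have ZE y mu : M mu -> Z y mu = q y mu :> (T -> R).
  by move=> Mmu; exact: (insubdK (0 : LfunType P p1) (quantile_Lfun y Mmu)).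
have [del del0 Hdel] := convex_monotone_continuous rho_convex rho_nondecreasing (Z x nu) eps0.
have c0 : 0 < 3 `^ p :> R by exact: powR_gt0.
pose tau := del / (8 * 3 `^ p).
have tau0 : 0 < tau by rewrite divr_gt0// mulr_gt0.
have [K K0 near_tail] := near_tail_powR x Mnu tau0.
pose h := tau `^ p^-1 / 2.
have h0 : 0 < h by rewrite divr_gt0// powR_gt0.
have hE : (2 * h) `^ p = tau.
  rewrite /h mulrC divfK// -powRrM mulVf ?gt_eqF// powRr1//; exact: ltW.
pose m := (Num.truncn (2 * K / h)).+1.
have Km : 2 * K <= m%:R * h.
  by rewrite -ler_pdivrMr// ltW// Num.Theory.truncnS_gt.
have k20 : 0 < (2 * K) `^ p * (m.+1%:R * 2) by rewrite !mulr_gt0// powR_gt0// mulr_gt0.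
pose eta := tau / ((2 * K) `^ p * (m.+1%:R * 2)).
have eta0 : 0 < eta by rewrite divr_gt0.
have etaE : (2 * K) `^ p * (m.+1%:R * (2 * eta)) = tau.
  by rewrite [m.+1%:R * _]mulrA mulrA mulrC divfK// gt_eqF.
pose t (j : nat) : R := - K + j%:R * h.
have FF : Filter (filter_prod (nbhs x) (within M (nbhs nu))).
  exact: filter_prod_filter.
have near_t : filter_prod (nbhs x) (within M (nbhs nu))
    [set e : 'rV[R]_n * probability 'rV[R]_s R | forall j : 'I_m.+1,
      (@cdf _ _ R (\d_(e.1) \x e.2)%E f (t j) <=
       @cdf _ _ R (\d_x \x nu)%E f (t j + h) + eta%:E)%E /\
      (@cdf _ _ R (\d_x \x nu)%E f (t j) <=
       @cdf _ _ R (\d_(e.1) \x e.2)%E f (t j + h) + eta%:E)%E].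
  (* There are finitely many grid points, so a single neighborhood serves for all of them. *)
  apply: (@filter_forall _ _ (fun (j : 'I_m.+1) (e : 'rV[R]_n * probability 'rV[R]_s R) =>
      (@cdf _ _ R (\d_(e.1) \x e.2)%E f (t j) <=
       @cdf _ _ R (\d_x \x nu)%E f (t j + h) + eta%:E)%E /\
      (@cdf _ _ R (\d_x \x nu)%E f (t j) <=
       @cdf _ _ R (\d_(e.1) \x e.2)%E f (t j + h) + eta%:E)%E) _ FF) => j.
  apply: filter_prod_within.
  exact: near_cdf.
have near_M : filter_prod (nbhs x) (within M (nbhs nu))
    [set e : 'rV[R]_n * probability 'rV[R]_s R | M e.2].
  exists (setT, M); last by move=> e [].
  by split; [exact: filterT | exact: withinT].
(* The neighborhood contains its center, which gives the tail bound at $(x,\nu)$ with the same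
   [K]. *)
have tail_x := filter_prod_within_point Mnu near_tail.
apply: filterS3 near_tail near_t near_M => -[x' mu] /= tail_x' cdf_x' Mmu.
apply: Hdel; rewrite (ZE x' mu Mmu) (ZE x nu Mnu).
apply: (@le_lt_trans _ _ (3 `^ p * (tau + (tau + tau) + tau))%:E); last first.
  rewrite lte_fin (_ : _ + _ = tau * 4); last by ring.
  rewrite /tau; have -> : 3 `^ p * (del / (8 * 3 `^ p) * 4) = del / 2.
    by field; rewrite gt_eqF.
  by rewrite ltr_pdivrMr//; lra.
rewrite -[X in X + tau](_ : tau + ((2 * h) `^ p +
    (2 * K) `^ p * (m.+1%:R * (2 * eta))) = _); last by rewrite hE etaE.
apply: (quantile_Lp_close U01 p0 K0 h0 (ltW eta0) Km tail_x' tail_x) => j jm.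
- exact: (cdf_x' (Ordinal (jm : (j < m.+1)%N))).1.
- exact: (cdf_x' (Ordinal (jm : (j < m.+1)%N))).2.
Qed.

End objective_continuity.

(** * Stability of parametric minimization *)

Section parametric_minimization.
Context (R : realType) (V S : topologicalType) (Q : V -> S -> R)
  (X : set V) (M : set S) (nu : S).
Hypotheses (X_neq0 : X !=set0) (Mnu : M nu).
Hypothesis Q_cont : forall (x : V) (eps : R), X x -> 0 < eps ->
  filter_prod (nbhs x) (within M (nbhs nu))
    [set e : V * S | `|Q e.1 e.2 - Q x nu| < eps].

Let phi (mu : S) : \bar R := ereal_inf [set (Q x mu)%:E | x in X].
Let Phi (mu : S) : set V := [set x | X x /\ (Q x mu)%:E = phi mu].

(** A form of Berge's maximum theorem for a constant constraint set, with continuity of [Q] only at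
    the points above [nu]. A point of [X] nearly optimal at [nu] stays so nearby, hence upper
    semicontinuity; compactness makes the lower bounds uniform over [X]. *)
Lemma parametric_minimization : usc_within M phi nu /\
  (compact X ->
    [/\ phi @ within M (nbhs nu) --> phi nu,
        set_usc_within M Phi nu,
        Phi nu !=set0 &
        compact (Phi nu)]).
Proof.
have phi_le x mu : X x -> (phi mu <= (Q x mu)%:E)%E.
  by move=> Xx; apply: ereal_inf_lbound; exists x.
have phi_usc : usc_within M (phi) nu.
  move=> a /ereal_inf_lt[_ [x Xx <-]]; rewrite lte_fin -subr_gt0.
  move=> /(Q_cont Xx)[[B C] /= [nB nC] BC].
  apply: filterS nC => mu Cmu; apply: (le_lt_trans (phi_le x mu Xx)).
  have := BC (x, mu) (conj (nbhs_singleton nB) Cmu).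
  by rewrite /= lte_fin ltr_norml; lra.
split=> // cX.
have [x0 /set_mem Xx0 x0min] : exists2 x, x \in X & forall y, y \in X -> Q x nu <= Q y nu.
  apply: compact_EVT_min => //; apply: continuous_in_subspaceT => x /set_mem Xx.
  apply/cvgrPdist_lt => eps /(Q_cont Xx)[[B C] /= [nB nC] BC].
  apply: filterS nB => y By; rewrite distrC.
  exact: (BC (y, nu) (conj By (nbhs_singleton nC Mnu))).
have phi_nu : phi nu = (Q x0 nu)%:E.
  apply: le_anti; rewrite phi_le//=; apply: le_ereal_inf_tmp => _ [y Xy <-].
  by rewrite lee_fin; apply: x0min; exact: mem_set.
(* The near-covering form of compactness: a property holding for $(y,\mu)$ near each $(x,\nu)$ with
   $x\in X$ holds on all of [X] at once for $\mu$ near $\nu$. *)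
have near_X := (compact_near_coveringP X).1 cX _ (within M (nbhs nu)).
split.
- move=> A; rewrite phi_nu => -[e /= e0 eA].
  have e2 : 0 < e / 2 by rewrite divr_gt0.
  (* Passing to the infimum weakens the strict inequality; [e / 2] keeps the result strictly within
     [e]. *)
  have lsc : within M (nbhs nu) [set mu | forall x, X x -> Q x0 nu - e / 2 < Q x mu].
    apply: (near_X (fun mu x => Q x0 nu - e / 2 < Q x mu)) => x Xx.
    apply: filterS (Q_cont Xx e2) => -[y mu] /=.
    have := x0min x (mem_set Xx); rewrite ltr_norml; lra.
  have usc : within M (nbhs nu) [set mu | (phi mu < (Q x0 nu + e)%:E)%E].
    by apply: phi_usc; rewrite phi_nu lte_fin; lra.
  apply: filterS2 lsc usc => mu h1 h2.
  have : ((Q x0 nu - e / 2)%:E <= phi mu)%E.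
    by apply: le_ereal_inf_tmp => _ [y Xy <-]; rewrite lee_fin ltW// h1.
  move: h2; rewrite /=; case: (phi mu) => // v; rewrite lte_fin lee_fin => h2 h3.
  by apply: eA; rewrite /= ltr_norml; lra.
- move=> O oO PhiO.
  (* As an implication on all of [X], the claim suits the covering argument: it is trivial near
     points of the open set [O]. *)
  suff : within M (nbhs nu) [set mu | forall x, X x -> ~ O x -> ~ Phi mu x].
    apply: filterS => mu H x [Xx Qx]; apply: contrapT => Ox.
    by apply: (H x Xx Ox); split.
  apply: (near_X (fun mu x => ~ O x -> ~ Phi mu x)) => x Xx.
  have [Ox|Ox] := pselect (O x).
    exists (O, setT); first by split; [exact: open_nbhs_nbhs | exact: filterT].
    by move=> [y mu] [/= Oy _] /(_ Oy).
  have Qx : Q x0 nu < Q x nu.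
    rewrite lt_neqAle x0min ?mem_set// andbT; apply/eqP => Qx; apply: Ox.
    by apply: PhiO; split => //; rewrite phi_nu Qx.
  (* Half the gap, so that for $(y,\mu)$ near $(x,\nu)$ the value [Q y mu] exceeds [Q x0 nu + e],
     which itself exceeds [phi mu]. *)
  pose e := (Q x nu - Q x0 nu) / 2.
  have e0 : 0 < e by rewrite divr_gt0// subr_gt0.
  have usc : within M (nbhs nu) [set mu | (phi mu < (Q x0 nu + e)%:E)%E].
    by apply: phi_usc; rewrite phi_nu lte_fin; lra.
  have [[B C] /= [nB nC] BC] := Q_cont Xx e0.
  exists (B, C `&` [set mu | (phi mu < (Q x0 nu + e)%:E)%E]).
    by split => //; exact: filterI.
  move=> [y mu] [/= By [Cmu usc_mu]] _ [_ Qy].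
  have := BC (y, mu) (conj By Cmu); move: usc_mu; rewrite /= -Qy lte_fin.
  rewrite ltr_norml /e; lra.
- by exists x0; split => //; rewrite phi_nu.
- move=> F PF FPhi; have FX : F X by apply: filterS FPhi => y [].
  have [x [Xx xF]] := cX F PF FX; exists x; split => //; split => //.
  rewrite phi_nu; congr EFin; apply/eqP; rewrite eq_le x0min ?mem_set// andbT.
  (* If the cluster point [x] were not optimal, its optimality gap could serve as tolerance; an
     optimal [y] near [x] would then differ from it in value by exactly that gap. *)
  rewrite leNgt; apply/negP; rewrite -subr_gt0 => /(Q_cont Xx)[[B C] /= [nB nC] BC].
  have [y [[Xy Qy] By]] := xF _ _ FPhi nB.
  have := BC (y, nu) (conj By (nbhs_singleton nC Mnu)).
  move: Qy; rewrite phi_nu => -[] Qy; rewrite /= Qy ltr_norml; lra.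
Qed.

End parametric_minimization.


Theorem corollary2 (R : realType)
  (p : R) (p1 : (1 <= p%:E)%E)
  (d : measure_display) (T : measurableType d) (P : probability T R)
  (U : {RV P >-> R}) (U01 : uniform01 U)
  (rho : LfunType P p1 -> R)
  (rho_convex : convex_function setT rho)
  (rho_nondecreasing : ae_nondecreasing rho)
  (rho_law_invariant : law_invariant rho)
  (n s : nat)
  (f : {mfun ('rV[R]_n * 'rV[R]_s)%type >-> R})
  (gamma : R) (gamma_gt0 : 0 < gamma)
  (f_limited : limited_by gamma f)
  (X : set 'rV[R]_n) (X_neq0 : X !=set0)
  (M : set (probability 'rV[R]_s R))
  (M_moment : M `<=` finite_moment (gamma * p))
  (M_integrating : locally_uniformly_integrating (gamma * p) M)
  (nu : probability 'rV[R]_s R) (M_nu : M nu)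
  (nu_Df : forall x, X x -> (\d_x \x nu)%E (discontinuity_points f) = 0%E) :
  let phi := optval rho U f X in
  let Phi := optset rho U f X in
  usc_within M phi nu /\
  (compact X ->
    [/\ phi @ within M (nbhs nu) --> phi nu,
        set_usc_within M Phi nu,
        Phi nu !=set0 &
        compact (Phi nu)]).
Proof.
apply: (@parametric_minimization R _ _ (Qfun rho U f)) => //= x eps Xx eps0.
exact: (Qfun_continuous U01 rho_convex rho_nondecreasing f_limited M_moment
  M_integrating M_nu (nu_Df x Xx) eps0).
Qed.
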